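(* Let $n\ge 2$ and let $\mathfrak{B}_n$ be the group of signed permutations of $\{\pm1,\dots,\pm n\}$ in window notation $\pi=\pi_1\cdots\pi_n$. Let $\mathrm{negs}(\pi)=|\{i:\pi_i<0\}|$ and $\mathfrak{D}_n=\{\pi\in\mathfrak{B}_n:\mathrm{negs}(\pi)\text{ even}\}$. Let $\mathrm{inv}_D(\pi)=|\{1\le i<j\le n:\pi_i>\pi_j\}|+|\{1\le i<j\le n:-\pi_i>\pi_j\}|$, and $\mathfrak{D}_n^{+}$ (resp. $\mathfrak{D}_n^-$) the set of $\pi\in\mathfrak{D}_n$ with $\mathrm{inv}_D(\pi)$ even (resp. odd). Let $\mathrm{exc}_D(\pi)=|\{i\in[n]:\pi_{|\pi_i|}>\pi_i\}\cup\{i\in[n]:\pi_i=-i\}|$ and $\mathrm{DExc}_n^{\pm}(t)=\sum_{\pi\in\mathfrak{D}_n^{\pm}}t^{\mathrm{exc}_D(\pi)}$. Then the distribution of the coefficients of $\mathrm{DExc}_n^{+}(t)$ and of $\mathrm{DExc}_n^{-}(t)$ is asymptotically normal as $n\to\infty$. Over $\mathfrak{D}_n^{+}$ and over $\mathfrak{D}_n^-$ (uniform distribution), the random variable $\mathrm{exc}_D$ has mean $n/2$ when $n\ge 3$ and variance $(n+1)/12$ when $n\ge 4$.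
   Context: To a polynomial $P(t)=\sum_k p_k t^k$ with nonnegative coefficients and $P(1)>0$ associate the random variable $X$ with $\Pr(X=k)=p_k/P(1)$. A sequence of such polynomials $P_n(t)=\sum_k p_{n,k}t^k$ has asymptotically normal coefficient distribution if, with $\mu_n,\sigma_n^2$ the mean and variance of the associated random variable, $\lim_{n\to\infty}\sup_{x\in\mathbb{R}}\left|\sum_{k\le\lfloor x\sigma_n+\mu_n\rfloor}\frac{p_{n,k}}{P_n(1)}-\Phi(x)\right|=0$, where $\Phi$ is the standard normal cumulative distribution function. *)

(* Defs.v *)
From HB Require Import structures.
From mathcomp Require Import all_boot all_order all_algebra fingroup perm.
From mathcomp Require Import all_classical all_reals all_analysis.

Set Implicit Arguments.
Unset Strict Implicit.
Unset Printing Implicit Defensive.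
Import Order.TTheory GRing.Theory Num.Theory.
Import numFieldNormedType.Exports.

Local Open Scope ring_scope.

(** The letters {±1, ..., ±n}: (false, i) stands for i + 1 and (true, i) for
    -(i + 1), because ordinals start at 0. *)
Definition letter (n : nat) : finType := (bool * 'I_n)%type.

Definition letter_val (n : nat) (x : letter n) : int :=
  if x.1 then - (x.2.+1)%:Z else (x.2.+1)%:Z.

Definition letter_opp (n : nat) (x : letter n) : letter n := (~~ x.1, x.2).

Definition signed_perms (n : nat) : {set {perm letter n}} :=
  [set p : {perm letter n} |
    [forall x, p (letter_opp x) == letter_opp (p x)]]%SET.

(** [window p i] is the integer pi_(i+1), and [window_abs p i] is the 0-based
    index of |pi_(i+1)|. *)
Definition window (n : nat) (p : {perm letter n}) (i : 'I_n) : int :=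
  letter_val (p (false, i)).

Definition window_abs (n : nat) (p : {perm letter n}) (i : 'I_n) : 'I_n :=
  (p (false, i)).2.

Definition negs (n : nat) (p : {perm letter n}) : nat :=
  #|[set i : 'I_n | window p i < 0]%SET|.

Definition Dn (n : nat) : {set {perm letter n}} :=
  [set p in signed_perms n | ~~ odd (negs p)]%SET.

Definition invD (n : nat) (p : {perm letter n}) : nat :=
  (#|[set ij : 'I_n * 'I_n |
       ((ij.1 < ij.2)%N && (window p ij.1 > window p ij.2)%R)]%SET|
   + #|[set ij : 'I_n * 'I_n |
       ((ij.1 < ij.2)%N && (- window p ij.1 > window p ij.2)%R)]%SET|)%N.

Definition Dn_plus (n : nat) : {set {perm letter n}} :=
  [set p in Dn n | ~~ odd (invD p)]%SET.

Definition Dn_minus (n : nat) : {set {perm letter n}} :=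
  [set p in Dn n | odd (invD p)]%SET.

Definition excD (n : nat) (p : {perm letter n}) : nat :=
  #|([set i : 'I_n | window p (window_abs p i) > window p i]
     :|: [set i : 'I_n | window p i == - (i.+1)%:Z])%SET|.

Definition DExc_plus (R : realType) (n : nat) : {poly R} :=
  \sum_(p in Dn_plus n) 'X^(excD p).

Definition DExc_minus (R : realType) (n : nat) : {poly R} :=
  \sum_(p in Dn_minus n) 'X^(excD p).

(** Mean and variance of [f] under the uniform distribution on [A]. *)
Definition unif_mean (R : realType) (T : finType) (A : {set T})
    (f : T -> nat) : R :=
  (\sum_(x in A) (f x)%:R) / #|A|%:R.

Definition unif_variance (R : realType) (T : finType) (A : {set T})
    (f : T -> nat) : R :=
  (\sum_(x in A) ((f x)%:R - unif_mean R A f) ^+ 2) / #|A|%:R.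

Section CoefficientDistribution.
Variable R : realType.
Implicit Type P : {poly R}.

Definition has_coef_distribution P : Prop :=
  (forall k, 0 <= P`_k) /\ 0 < P.[1].

Definition coef_prob P (k : nat) : R := P`_k / P.[1].

Definition coef_mean P : R := \sum_(k < size P) k%:R * coef_prob P k.

Definition coef_variance P : R :=
  \sum_(k < size P) (k%:R - coef_mean P) ^+ 2 * coef_prob P k.

Definition coef_cdf_std P (x : R) : R :=
  let y := x * Num.sqrt (coef_variance P) + coef_mean P in
  \sum_(k < size P | k%:Z <= Num.floor y) coef_prob P k.

Definition Phi (x : R) : R := fine (normal_prob (0 : R) 1 `]-oo, x]%classic).

(** The supremum is taken in the extended reals, where it always exists.  The
    first conjunct is only asked eventually: for small [n] a family such as
    [DExc_minus] may be the zero polynomial. *)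
Definition asymptotically_normal (P : nat -> {poly R}) : Prop :=
  (\forall n \near \oo%classic, has_coef_distribution (P n)) /\
  ((fun n => ereal_sup
      [set (`|coef_cdf_std (P n) x - Phi x|)%:E | x in [set: R]%classic])
    @ \oo --> 0%:E)%classic.

End CoefficientDistribution.

(* Main.v *)
From HB Require Import structures.
Require Import Defs.
From mathcomp Require Import all_boot all_order all_algebra fingroup perm.
From mathcomp Require Import all_classical all_reals all_analysis.
From mathcomp Require Import ring lra zify.
Set Implicit Arguments.
Unset Strict Implicit.
Unset Printing Implicit Defensive.
Import Order.TTheory GRing.Theory Num.Theory.
Import numFieldNormedType.Exports.
Local Open Scope ring_scope.

(** A signed permutation is a permutation [s = |pi|] together with a sign for
    each value; [exc_D] then counts the excedances of [s] for the order of the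
    signed values, plus the negative fixed points, and [inv_D] has the parity of
    [s].  Inserting [n + 1] or [-(n + 1)] into a cycle (or as a fixed point)
    changes these statistics in a controlled way, which gives a recurrence for
    all sums of [x ^ negs * y ^ inv * g exc].  For [x = -1] the recurrence
    collapses to an iterated difference of [g], and for [x = 1], [y = -1] it has
    a similar closed form; hence on either half of [D_n] the average of [g]
    equals that over [B_n] when [g] is a polynomial of low degree, and differs
    from it by at most [3 / n] when [|g| <= 1].

    Over [B_n] the recurrence says that [Y_n = exc - n / 2] is a Markov chain
    with steps [+-1/2], the step [+1/2] having probability
    [1/2 - Y_n / (n + 1)].  This gives the variance, and makes [n * Y_n] a
    martingale, to which Lindeberg's replacement argument applies with the
    explicit solution [Phi ((a - x) / sqrt tau)] of the heat equation as smooth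
    test function. *)

(** * Signed permutations *)

Section SignedPermutations.
Variable n : nat.
Implicit Types (e : {ffun 'I_n -> bool}) (s : 'S_n) (p : {perm letter n}).

Definition signed_perm_fun e s (x : letter n) : letter n :=
  (x.1 (+) e (s x.2), s x.2).

Lemma signed_perm_fun_inj e s : injective (signed_perm_fun e s).
Proof.
move=> [a i] [b j]; rewrite /signed_perm_fun /= => -[h /perm_inj ij].
by move: h; rewrite ij => /addIb ->.
Qed.

(** [e] records the sign of each value of [|pi|], not of each position. *)
Definition signed_perm e s : {perm letter n} :=
  perm (@signed_perm_fun_inj e s).

Lemma signed_permE e s x : signed_perm e s x = (x.1 (+) e (s x.2), s x.2).
Proof. by rewrite permE. Qed.

Lemma signed_perm_inj : injective (fun es => signed_perm es.1 es.2).
Proof.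
move=> [e s] [e' s'] /= /permP eq_es.
have ss' : s = s'.
  by apply/permP => i; have := eq_es (false, i); rewrite !signed_permE => -[].
subst s'; congr (_, _); apply/ffunP => i.
by have := eq_es (false, (s^-1)%g i); rewrite !signed_permE /= permKV => -[].
Qed.

Lemma signed_permsE :
  signed_perms n = ((fun es => signed_perm es.1 es.2) @: [set: _])%SET.
Proof.
apply/setP => p; rewrite inE; apply/forallP/imsetP => [sp|[[e s] _ ->]] /=; last first.
  by move=> [a i]; rewrite !signed_permE /letter_opp /= addNb.
have p_opp b i : p (b, i) = (b (+) (p (false, i)).1, (p (false, i)).2).
  case: b => /=; last by case: (p _).
  by have /eqP := sp (false, i); rewrite /letter_opp.
(* Two positive letters whose images agree up to sign have either equal images, or the image of one
   is that of the opposite of the other. Both cases contradict injectivity of [p]. *)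
have inj_s : injective (fun i => (p (false, i)).2).
  move=> i j ij; case: (eqVneq (p (false, i)).1 (p (false, j)).1) => h.
    have : p (false, i) = p (false, j).
      by rewrite [LHS]surjective_pairing [RHS]surjective_pairing h ij.
    by move=> /perm_inj [].
  have : p (false, i) = p (true, j).
    rewrite (p_opp true) [LHS]surjective_pairing ij; congr (_, _).
    by move: h; case: (p _).1; case: (p _).1.
  by move=> /perm_inj [].
pose s := perm inj_s.
exists ([ffun j => (p (false, (s^-1)%g j)).1], s) => //=.
apply/permP => -[b i]; rewrite signed_permE /= ffunE permK p_opp.
by rewrite permE.
Qed.

Lemma sum_signed_perms (V : nmodType) (F : {perm letter n} -> V) :
  \sum_(p in signed_perms n) F p = \sum_es F (signed_perm es.1 es.2).
Proof.
rewrite signed_permsE big_imset /=; last by move=> es es' _ _ /signed_perm_inj.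
by apply: eq_bigl => es; rewrite inE.
Qed.

(** Indexed by the value [j = |pi_i|] instead of the position [i]: then [pi_i] is the signed letter
    of [j], and [pi_(|pi_i|)] is that of [s j]. *)
Definition exc_at e s (j : 'I_n) : bool :=
  (letter_val (e j, j) < letter_val (e (s j), s j)) || ((s j == j) && e j).

Definition wexc e s : nat := (\sum_(j < n) exc_at e s j)%N.

Lemma window_signed_perm e s i :
  window (signed_perm e s) i = letter_val (e (s i), s i).
Proof. by rewrite /window signed_permE. Qed.

Lemma excD_signed_perm e s : excD (signed_perm e s) = wexc e s.
Proof.
rewrite /excD -sum1_card big_mkcond /= /wexc [RHS](reindex_inj (@perm_inj _ s)) /=.
apply: eq_bigr => i _; rewrite !inE !window_signed_perm /window_abs signed_permE /=.
rewrite /exc_at (inj_eq (@perm_inj _ s)).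
have -> : (letter_val (e (s i), s i) == - (i.+1)%:Z) = (s i == i) && e (s i).
  rewrite /letter_val /= -(inj_eq (@ord_inj n)).
  by case: (e (s i)) => /=; apply/idP/idP; lia.
by case: (_ || _).
Qed.

Lemma negs_signed_perm e s : negs (signed_perm e s) = (\sum_(j < n) e j)%N.
Proof.
rewrite /negs -sum1_card big_mkcond /= [RHS](reindex_inj (@perm_inj _ s)) /=.
apply: eq_bigr => i _; rewrite !inE window_signed_perm /letter_val /=.
by case: (e (s i)).
Qed.

End SignedPermutations.

(** Permuting the columns of the Vandermonde matrix on [0, ..., n - 1] multiplies its positive
    determinant by the sign of [s]. The factor of the pair [i < j] becomes negative exactly at an
    inversion. *)
Lemma sign_perm_inversions n (s : 'S_n) :
  (-1) ^+ s =
  \prod_(i < n) \prod_(j < n | (i < j)%N) (-1) ^+ (s j < s i)%N :> int.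
Proof.
pose a : 'rV[int]_n := \row_i (i : nat)%:Z.
have posV : 0 < \prod_(i < n) \prod_(j < n | (i < j)%N) (a 0 j - a 0 i).
  apply: prodr_gt0 => i _; apply: prodr_gt0 => j ij; rewrite !mxE; lia.
have eqV : \prod_(i < n) \prod_(j < n | (i < j)%N) (a 0 (s j) - a 0 (s i)) =
    (-1) ^+ s * \prod_(i < n) \prod_(j < n | (i < j)%N) (a 0 j - a 0 i).
  have := det_Vandermonde (col_perm s a).
  rewrite (_ : Vandermonde n (col_perm s a) = col_perm s (Vandermonde n a)).
    rewrite col_permE det_mulmx det_perm det_Vandermonde mulrC odd_permV => ->.
    by apply: eq_bigr => i _; apply: eq_bigr => j _; rewrite !mxE.
  by apply/matrixP => i j; rewrite !mxE.
have sgV : forall z : int, 0 < z -> forall b : bool, Num.sg ((-1) ^+ b * z) = (-1) ^+ b.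
  by move=> z z0 b; rewrite sgrM (gtr0_sg z0) mulr1; case: b; rewrite ?expr1 ?sgrN ?sgr1.
rewrite -(sgV _ posV) -eqV.
rewrite (big_morph _ (@sgrM int) (@sgr1 int)); apply: eq_bigr => i _.
rewrite (big_morph _ (@sgrM int) (@sgr1 int)); apply: eq_bigr => j ij.
rewrite !mxE.
have : s j != s i by rewrite (inj_eq (@perm_inj _ s)); apply: contraTneq ij => ->; rewrite ltnn.
rewrite -(inj_eq (@ord_inj n)) neq_ltn => /orP[h|h].
  by rewrite h /= ltr0_sg //; lia.
by rewrite ltnNge (ltnW h) /= gtr0_sg //; lia.
Qed.

(** Fix [i < j]. If [|pi_i| < |pi_j|], the conditions [pi_i > pi_j] and [- pi_i > pi_j] hold both or
    neither; if [|pi_i| > |pi_j|], exactly one holds. So modulo 2 only the inversions of [s]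
    count. *)
Lemma odd_invD_signed_perm n (e : {ffun 'I_n -> bool}) (s : 'S_n) :
  odd (invD (signed_perm e s)) = s.
Proof.
suff : (-1) ^+ (invD (signed_perm e s)) = (-1) ^+ s :> int.
  by rewrite -signr_odd; case: odd; case: (s : bool).
have exprC (I : finType) (A : {set I}) : (-1) ^+ #|A| = \prod_i (-1) ^+ (i \in A) :> int.
  rewrite -sum1_card -prodrXr big_mkcond /=.
  by apply: eq_bigr => i _; case: ifP.
rewrite sign_perm_inversions /invD exprD !exprC -big_split /= pair_big_dep /= [RHS]big_mkcond.
apply: eq_bigr => -[i j] _ /=; rewrite !inE /=.
case: ifP => //= ij; rewrite !window_signed_perm.
have : s j != s i by rewrite (inj_eq (@perm_inj _ s)); apply: contraTneq ij => ->; rewrite ltnn.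
rewrite -(inj_eq (@ord_inj n)) /letter_val => uv.
have -> : (s j < s i)%N = ((s j).+1%:Z < (s i).+1%:Z) by lia.
have : (s j).+1%:Z != (s i).+1%:Z by lia.
have : 0 < (s j).+1%:Z by lia.
have : 0 < (s i).+1%:Z by lia.
cbn [fst snd]; move: (s i).+1%:Z (s j).+1%:Z => x y x0 y0 xy.
case: (e (s i)); case: (e (s j));
  do ?(case: ltrP => ? /=); rewrite ?expr0 ?expr1 //; lia.
Qed.

(** * Insertion of the largest letter *)

Lemma letter_val_lift n b (k : 'I_n) :
  letter_val (b, lift ord_max k) = letter_val (b, k).
Proof. by rewrite /letter_val; cbn [fst snd]; rewrite lift_max. Qed.

Lemma letter_val_lt_max n b c (k : 'I_n) :
  (letter_val (c, k) < letter_val (b, @ord_max n)) = ~~ b.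
Proof.
have := ltn_ord k; rewrite /letter_val; cbn [fst snd].
case: b; case: c => /=; lia.
Qed.

Lemma letter_val_max_lt n b c (k : 'I_n) :
  (letter_val (b, @ord_max n) < letter_val (c, k)) = b.
Proof.
have := ltn_ord k; rewrite /letter_val; cbn [fst snd].
case: b; case: c => /=; lia.
Qed.

Lemma big_ord_lift_max (V : nmodType) n (F : 'I_n.+1 -> V) :
  \sum_(i < n.+1) F i = F ord_max + \sum_(k < n) F (lift ord_max k).
Proof.
rewrite big_ord_recr addrC; congr (_ + _); apply: eq_bigr => k _; congr F.
by apply: ord_inj; rewrite lift_max.
Qed.

Section Insertion.
Variable n : nat.
Implicit Types (e : {ffun 'I_n -> bool}) (s : 'S_n).

Definition extend_signs e (b : bool) : {ffun 'I_n.+1 -> bool} :=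
  [ffun j => if unlift ord_max j is Some k then e k else b].

(** The letter [n + 1] is inserted after [i] in its cycle, and as a fixed point
    when [i] is [ord_max]. *)
Definition insert_max s (i : 'I_n.+1) : 'S_n.+1 :=
  (tperm i ord_max * lift_perm ord_max ord_max s)%g.

Lemma extend_signs_lift e b k : extend_signs e b (lift ord_max k) = e k.
Proof. by rewrite ffunE liftK. Qed.

Lemma extend_signs_max e b : extend_signs e b ord_max = b.
Proof. by rewrite ffunE unlift_none. Qed.

Lemma insert_max_id s i : insert_max s i i = ord_max.
Proof. by rewrite permM tpermL lift_perm_id. Qed.

Lemma insert_max_max s k : insert_max s (lift ord_max k) ord_max = lift ord_max (s k).
Proof. by rewrite permM tpermR lift_perm_lift. Qed.

Lemma insert_max_lift s i k :
  i != lift ord_max k -> insert_max s i (lift ord_max k) = lift ord_max (s k).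
Proof.
by move=> ik; rewrite permM tpermD ?lift_perm_lift // neq_lift.
Qed.

Lemma odd_insert_max s i : odd_perm (insert_max s i) = (i != ord_max) (+) s.
Proof. by rewrite odd_mul_tperm odd_lift_perm addbb. Qed.

Lemma insert_max_inj : injective (fun si => insert_max si.1 si.2).
Proof.
move=> [s i] [s' i'] /= eq_ins.
have ii' : i = i'.
  by apply: (@perm_inj _ (insert_max s i)); rewrite insert_max_id eq_ins insert_max_id.
subst i'; congr (_, _); apply/permP => k; apply: (@lift_inj _ ord_max).
by have := congr1 (fun t => (tperm i ord_max * t)%g (lift ord_max k)) eq_ins;
  rewrite /= !tpermKg !lift_perm_lift.
Qed.

Lemma extend_signs_inj : injective (fun eb => extend_signs eb.1 eb.2).
Proof.
move=> [e b] [e' b'] /= /ffunP eq_ext; congr (_, _); last first.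
  by have := eq_ext ord_max; rewrite !extend_signs_max.
by apply/ffunP => k; have := eq_ext (lift ord_max k); rewrite !extend_signs_lift.
Qed.

(** Insertion is injective, and both sides have [2 ^ (n + 1) * (n + 1)!] index tuples, so it is a
    bijection. *)
Lemma sum_insert (V : nmodType) (F : {ffun 'I_n.+1 -> bool} -> 'S_n.+1 -> V) :
  \sum_es F es.1 es.2 =
  \sum_es \sum_(b : bool) \sum_i F (extend_signs es.1 b) (insert_max es.2 i).
Proof.
pose h (x : {ffun 'I_n -> bool} * 'S_n * (bool * 'I_n.+1)) :=
  (extend_signs x.1.1 x.2.1, insert_max x.1.2 x.2.2).
have inj_h : injective h.
  move=> [[e s] [b i]] [[e' s'] [b' i']] [].
  by move=> /(@extend_signs_inj (_, _) (_, _)) [-> ->]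
            /(@insert_max_inj (_, _) (_, _)) [-> ->].
have bij_h : bijective h.
  apply: (inj_card_bij inj_h).
  rewrite !card_prod !card_ffun !card_ord card_bool !card_Sn factS expnS.
  by rewrite leq_eqVlt; apply/orP; left; apply/eqP; ring.
rewrite (reindex h) /=; last exact: onW_bij.
under [RHS]eq_bigr do rewrite pair_big.
by rewrite pair_big.
Qed.

Lemma wexc_insert_max e s b :
  wexc (extend_signs e b) (insert_max s ord_max) = (wexc e s + b)%N.
Proof.
rewrite /wexc [LHS]big_ord_lift_max addnC; congr (_ + _)%N.
  by rewrite /exc_at insert_max_id extend_signs_max ltxx eqxx.
apply: eq_bigr => k _; rewrite /exc_at extend_signs_lift insert_max_lift ?neq_lift //.
by rewrite extend_signs_lift !letter_val_lift (inj_eq lift_inj).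
Qed.

(** The arc from [k] to [s k] is replaced by two arcs through the new letter. Whatever the sign [b],
    exactly one of these is an excedance, so the count grows unless the broken arc was counted
    already. *)
Lemma wexc_insert_lift e s b k :
  wexc (extend_signs e b) (insert_max s (lift ord_max k)) =
  (wexc e s + ~~ exc_at e s k)%N.
Proof.
rewrite /wexc [LHS]big_ord_lift_max (bigD1 k) //= [in RHS](bigD1 k) //=.
rewrite (eq_bigr (fun j => exc_at e s j : nat)); last first.
  move=> j jk; rewrite /exc_at extend_signs_lift insert_max_lift; last first.
    by rewrite (inj_eq lift_inj) eq_sym.
  by rewrite extend_signs_lift !letter_val_lift (inj_eq lift_inj).
have -> : exc_at (extend_signs e b) (insert_max s (lift ord_max k)) ord_max = b.
  rewrite /exc_at insert_max_max extend_signs_lift extend_signs_max letter_val_lift.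
  by rewrite letter_val_max_lt eq_sym (negbTE (neq_lift _ _)) orbF.
have -> : exc_at (extend_signs e b) (insert_max s (lift ord_max k)) (lift ord_max k) = ~~ b.
  rewrite /exc_at insert_max_id extend_signs_lift extend_signs_max letter_val_lift.
  by rewrite letter_val_lt_max (negbTE (neq_lift _ _)) orbF.
set S := (\sum_(i < n | i != k) _)%N.
rewrite [LHS](_ : _ = b + (~~ b + S))%N //.
by case: b; case: (exc_at e s k) => /=; lia.
Qed.

End Insertion.

Section SignedSum.
Variable R : comNzRingType.
Implicit Types (x y : R) (g : nat -> R).

Definition signed_sum x y n g : R :=
  \sum_(es : {ffun 'I_n -> bool} * 'S_n)
    x ^+ (\sum_(j < n) es.1 j) * y ^+ (es.2 : bool) * g (wexc es.1 es.2).

(** The first two terms are the positive and the negative new fixed point. The last one collects,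
    for either sign, the [n] arcs that can be broken: [k] of them keep the count and [n - k] raise
    it, with a factor [y] for the change of parity. *)
Definition insertion_step x y n g (k : nat) : R :=
  g k + x * g k.+1 + (1 + x) * y * (k%:R * g k + (n%:R - k%:R) * g k.+1).

Lemma signed_sumS x y n g : y ^+ 2 = 1 ->
  signed_sum x y n.+1 g = signed_sum x y n (insertion_step x y n g).
Proof.
move=> y2; rewrite /signed_sum.
rewrite (sum_insert (fun e s => x ^+ (\sum_(j < n.+1) e j) * y ^+ (s : bool) * g (wexc e s))).
apply: eq_bigr => -[e s] _ /=.
have negsE b : (\sum_(j < n.+1) extend_signs e b j = b + \sum_(j < n) e j)%N.
  rewrite [LHS]big_ord_lift_max extend_signs_max; congr (_ + _)%N.
  by apply: eq_bigr => k _; rewrite extend_signs_lift.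
have sumE : \sum_(k < n) g (wexc e s + ~~ exc_at e s k)%N =
    (wexc e s)%:R * g (wexc e s) + (n%:R - (wexc e s)%:R) * g (wexc e s).+1.
  rewrite (eq_bigr (fun k => (exc_at e s k)%:R * g (wexc e s) +
      (1 - (exc_at e s k)%:R) * g (wexc e s).+1)); last first.
    move=> k _; case: exc_at => /=; rewrite ?addn0 ?addn1; ring.
  rewrite big_split /= -!mulr_suml; congr (_ * _ + _ * _).
    by rewrite /wexc natr_sum.
  by rewrite sumrB /wexc natr_sum sumr_const card_ord.
have stepE b : \sum_i
   x ^+ (\sum_(j < n.+1) extend_signs e b j) * y ^+ (insert_max s i : bool) *
     g (wexc (extend_signs e b) (insert_max s i)) =
   x ^+ b * (x ^+ (\sum_(j < n) e j) * y ^+ (s : bool) *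
     (g (wexc e s + b)%N +
      y * ((wexc e s)%:R * g (wexc e s) + (n%:R - (wexc e s)%:R) * g (wexc e s).+1))).
  rewrite big_ord_lift_max negsE odd_insert_max eqxx addFb wexc_insert_max.
  rewrite (eq_bigr (fun k => x ^+ (b + \sum_(j < n) e j) * (y * y ^+ (s : bool)) *
      g (wexc e s + ~~ exc_at e s k)%N)); last first.
    move=> k _; rewrite odd_insert_max wexc_insert_lift eq_sym neq_lift addTb.
    by congr (_ * _ * _); case: (s : bool) => /=; rewrite ?expr0 ?expr1 ?mulr1 -?expr2.
  rewrite -mulr_sumr sumE exprD.
  move: (x ^+ b) (x ^+ (\sum_(j < n) e j)) (y ^+ (s : bool)) => u v w.
  move: (wexc e s)%:R (g (wexc e s)) (g (wexc e s).+1) (g (wexc e s + b)%N) => k a c d.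
  ring.
rewrite big_bool /= !stepE /insertion_step [nat_of_bool true]/= [nat_of_bool false]/=.
rewrite addn0 addn1 expr0 expr1; move: (x ^+ (\sum_(j < n) e j)) (y ^+ (s : bool)) => u v.
ring.
Qed.

Lemma signed_sum0 x y g : signed_sum x y 0 g = g 0%N.
Proof.
rewrite /signed_sum (eq_bigl (pred1 (finfun (fun=> true), 1%g))).
  by rewrite big_pred1_eq /= odd_perm1 /wexc !big_ord0 !expr0 !mul1r.
move=> [e s]; symmetry; apply/eqP; congr (_, _).
  by apply/ffunP => -[].
by apply/permP => -[].
Qed.

End SignedSum.

(** * Signed sums and finite differences *)

Section FiniteDifferences.
Variable R : comNzRingType.
Implicit Type g : nat -> R.

(** The operator [1 - t], where [t] is the shift of [g]. *)
Definition fdiff g (k : nat) : R := g k - g k.+1.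

Lemma iter_fdiffS m g k :
  iter m.+1 fdiff g k = iter m fdiff g k - iter m fdiff g k.+1.
Proof. by []. Qed.

Lemma iter_fdiff_lin m (a b : R) f g k :
  iter m fdiff (fun j => a * f j + b * g j) k =
  a * iter m fdiff f k + b * iter m fdiff g k.
Proof. by elim: m k => [//|m IH] k; rewrite !iter_fdiffS !IH; ring. Qed.

Lemma iter_fdiff_shift m g k :
  iter m fdiff (fun j => g j.+1) k = iter m fdiff g k.+1.
Proof. by elim: m k => [//|m IH] k; rewrite !iter_fdiffS !IH. Qed.

(** A Leibniz rule: commuting one difference past the factor [j] leaves minus a shift. It handles
    the factor [k] in [insertion_step]. *)
Lemma iter_fdiff_natM m g k :
  iter m fdiff (fun j => j%:R * fdiff g j) k =
  k%:R * iter m.+1 fdiff g k - m%:R * iter m fdiff g k.+1.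
Proof.
elim: m k => [|m IH] k; first by rewrite /= mul0r subr0.
rewrite iter_fdiffS !IH (iter_fdiffS m.+1) -[m.+1%:R]natr1 -[k.+1%:R]natr1.
rewrite (iter_fdiffS m _ k.+1); ring.
Qed.

Lemma iter_fdiff_eq0 r m g k : (r <= m)%N ->
  (forall j, iter r fdiff g j = 0) -> iter m fdiff g k = 0.
Proof.
move=> + g0; elim: m k => [|m IH] k; first by rewrite leqn0 => /eqP r0; rewrite -(g0 k) r0.
rewrite leq_eqVlt => /orP[/eqP <- //|]; rewrite ltnS => rm.
by rewrite iter_fdiffS !IH // subr0.
Qed.

Lemma eq_iter_fdiff m f g k : f =1 g -> iter m fdiff f k = iter m fdiff g k.
Proof. by move=> fg; elim: m k => [|m IH] k; rewrite ?fg // !iter_fdiffS !IH. Qed.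

Lemma eq_signed_sum (x y : R) n f g :
  f =1 g -> signed_sum x y n f = signed_sum x y n g.
Proof. by move=> fg; apply: eq_bigr => es _; rewrite fg. Qed.

(** At [x = -1] the factor [1 + x] removes all insertions into cycles. The two kinds of fixed point
    remain, and together they form one difference. *)
Lemma signed_sum_negs (y : R) n g : y ^+ 2 = 1 ->
  signed_sum (-1) y n g = iter n fdiff g 0%N.
Proof.
move=> y2; elim: n g => [|n IH] g; first by rewrite signed_sum0.
rewrite signed_sumS // IH iterSr; apply: eq_iter_fdiff => k.
by rewrite /insertion_step /fdiff; ring.
Qed.

(** In terms of generating polynomials: [(1 - t) ^ n] for even [n] and
    [(1 - t) ^ (n - 1) * (1 + t)] for odd [n]. *)
Lemma signed_sum_inv n g :
  signed_sum 1 (-1) n g =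
  if odd n then iter n.-1 fdiff (fun k => g k + g k.+1) 0%N
  else iter n fdiff g 0%N.
Proof.
elim: n g => [|n IH] g; first by rewrite signed_sum0.
rewrite signed_sumS ?sqrrN ?expr1n // IH {IH} /=; case: ifP => [odd_n|even_n] /=.
- case: n odd_n => // m _; rewrite [m.+1.-1]/=.
  pose G k := g k + g k.+1.
  (* The step is arranged so that [k] multiplies only a difference, as [iter_fdiff_natM] requires;
     evaluation at 0 then removes the term that still carries [k]. *)
  rewrite (@eq_iter_fdiff _ _ (fun k => 1 * (1 * G k + (-1 - 2%:R * m%:R) * G k.+1) +
     (-2%:R) * (1 * (k%:R * fdiff G k) + 1 * fdiff g k.+1))); last first.
    move=> k; rewrite /insertion_step /G /fdiff -[k.+1%:R]natr1 -[m.+1%:R]natr1; ring.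
  rewrite !iter_fdiff_lin iter_fdiff_natM !iter_fdiff_shift.
  have GE j : iter m fdiff G j = iter m fdiff g j + iter m fdiff g j.+1.
    rewrite (@eq_iter_fdiff _ _ (fun k => 1 * g k + 1 * g k.+1)); last by move=> k; rewrite !mul1r.
    by rewrite iter_fdiff_lin iter_fdiff_shift !mul1r.
  rewrite -iterSr !GE -!iterS !iter_fdiffS.
  ring.
- rewrite (@eq_iter_fdiff _ _ (fun k => 1 * (g k + g k.+1) +
     (-2%:R) * (1 * (k%:R * fdiff g k) + n%:R * g k.+1))); last first.
    by move=> k; rewrite /insertion_step /fdiff; ring.
  rewrite !iter_fdiff_lin iter_fdiff_natM !iter_fdiff_shift.
  by ring.
Qed.

End FiniteDifferences.

Arguments fdiff {R}.

Lemma iter_fdiff_bound (R : realDomainType) m (g : nat -> R) (M : R) k :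
  (forall j, `|g j| <= M) -> `|iter m fdiff g k| <= 2 ^+ m * M.
Proof.
move=> gM; elim: m k => [|m IH] k; first by rewrite expr0 mul1r.
rewrite iter_fdiffS (le_trans (ler_normB _ _)) // exprS -mulrA mulr2n mulrDl !mul1r.
by rewrite lerD.
Qed.

(** * The two halves of [D_n] *)

Definition Dn_part (c : bool) n : {set {perm letter n}} :=
  [set p in Dn n | odd (invD p) == c]%SET.

Lemma Dn_plusE n : Dn_plus n = Dn_part false n.
Proof. by apply/setP => p; rewrite !inE eqbF_neg. Qed.

Lemma Dn_minusE n : Dn_minus n = Dn_part true n.
Proof. by apply/setP => p; rewrite !inE eqb_id. Qed.

(** The product [(1 + (-1) ^ negs) * (1 + (-1) ^ c * (-1) ^ inv)] is 4 on the chosen half and 0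
    elsewhere. *)
Lemma sum_Dn_part (R : comNzRingType) c n (g : nat -> R) :
  4%:R * \sum_(p in Dn_part c n) g (excD p) =
  signed_sum 1 1 n g + signed_sum (-1) 1 n g +
  (-1) ^+ c * (signed_sum 1 (-1) n g + signed_sum (-1) (-1) n g).
Proof.
have -> : \sum_(p in Dn_part c n) g (excD p) =
    \sum_(p in signed_perms n)
      (if ~~ odd (negs p) && (odd (invD p) == c) then g (excD p) else 0).
  rewrite -big_mkcondr /=; apply: eq_bigl => p.
  by rewrite !inE andbA.
rewrite sum_signed_perms /signed_sum -!big_split !mulr_sumr -big_split /=.
apply: eq_bigr => -[e s] _ /=.
rewrite negs_signed_perm excD_signed_perm odd_invD_signed_perm !expr1n.
rewrite -(signr_odd _ (\sum_(j < n) e j)); move: (g _) (odd _) => a b.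
by case: b; case: (s : bool); case: c; rewrite /= ?expr0 ?expr1; ring.
Qed.

(** * Averages over the hyperoctahedral group *)

Section Average.
Variable R : realFieldType.
Implicit Types (f g : nat -> R) (n : nat).

Definition avgB n g : R := signed_sum 1 1 n g / (2 ^ n * n`!)%:R.

Lemma signed_sum11 n g :
  signed_sum 1 1 n g = \sum_(es : {ffun 'I_n -> bool} * 'S_n) g (wexc es.1 es.2).
Proof. by apply: eq_bigr => es _; rewrite !expr1n !mul1r. Qed.

Lemma wexc_le n (e : {ffun 'I_n -> bool}) (s : 'S_n) : (wexc e s <= n)%N.
Proof.
rewrite -[X in (_ <= X)%N]card_ord -sum1_card; apply: leq_sum => j _.
exact: leq_b1.
Qed.

Lemma le_avgB n f g :
  (forall k, (k <= n)%N -> f k <= g k) -> avgB n f <= avgB n g.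
Proof.
move=> fg; rewrite ler_wpM2r ?invr_ge0 ?ler0n // !signed_sum11.
by apply: ler_sum => es _; apply/fg/wexc_le.
Qed.

Lemma eq_avgB n f g : f =1 g -> avgB n f = avgB n g.
Proof. by move=> fg; rewrite /avgB (eq_signed_sum _ _ _ fg). Qed.

Lemma avgB_lin n (a b : R) f g :
  avgB n (fun k => a * f k + b * g k) = a * avgB n f + b * avgB n g.
Proof.
by rewrite /avgB !signed_sum11 big_split /= -!mulr_sumr mulrDl !mulrA.
Qed.

(** Of the [2 * (n + 1)] insertions, [2 * (n - k) + 1] raise the count; the weights are the
    transition probabilities of the chain. *)
Lemma avgBS n g :
  avgB n.+1 g = avgB n (fun k =>
    (2^-1 - (k%:R - n%:R / 2) / n.+1%:R) * g k.+1 +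
    (2^-1 + (k%:R - n%:R / 2) / n.+1%:R) * g k).
Proof.
rewrite /avgB signed_sumS ?expr1n // expnS factS mulnACA natrM natrM.
have n0 : n.+1%:R != 0 :> R by rewrite pnatr_eq0.
have m0 : (2 ^ n * n`!)%:R != 0 :> R.
  by rewrite pnatr_eq0 muln_eq0 expn_eq0 /= -lt0n fact_gt0.
set M := (2 ^ n * n`!)%:R.
rewrite invfM mulrA; congr (_ / _).
rewrite !signed_sum11 mulr_suml; apply: eq_bigr => es _ /=.
move: (wexc _ _) => k; rewrite /insertion_step -[n.+1%:R]natr1 in n0 *.
by field.
Qed.

Lemma avgB0 g : avgB 0 g = g 0%N.
Proof. by rewrite /avgB signed_sum0 divr1. Qed.

Lemma avgB_cst n (a : R) : avgB n (fun=> a) = a.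
Proof.
elim: n => [|n IH]; first by rewrite avgB0.
rewrite avgBS -[RHS]IH; apply: eq_avgB => k; field.
by rewrite addrC natr1 pnatr_eq0.
Qed.

Lemma ler_norm_avgB n f : `|avgB n f| <= avgB n (fun k => `|f k|).
Proof.
rewrite normrM [X in _ * X]ger0_norm ?invr_ge0 ?ler0n //.
by rewrite ler_wpM2r ?invr_ge0 ?ler0n // !signed_sum11 ler_norm_sum.
Qed.

(** A step multiplies the conditional mean of [Y_n] by [n / (n + 1)], which is also the martingale
    property of [n * Y_n]. *)
Lemma avgB_centered n : avgB n (fun k => k%:R - n%:R / 2) = 0.
Proof.
elim: n => [|n IH]; first by rewrite avgB0 mul0r subrr.
rewrite avgBS (@eq_avgB _ _ (fun k => (n%:R / n.+1%:R) * (k%:R - n%:R / 2) + 0 * 0)).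
  by rewrite avgB_lin IH mulr0 mul0r addr0.
have n0 : n.+1%:R != 0 :> R by rewrite pnatr_eq0.
by move=> k; rewrite -[k.+1%:R]natr1 -[n.+1%:R]natr1 in n0 *; field.
Qed.

Lemma avgB_mean n : avgB n (fun k => k%:R) = n%:R / 2.
Proof.
rewrite -[RHS]addr0 -(avgB_centered n) -[X in X + _](avgB_cst n).
rewrite -[RHS]mul1r mulrDr -avgB_lin; apply: eq_avgB => k; ring.
Qed.

(** The drift [- Y_n / (n + 1)] contributes [-2 * Y_n ^ 2 / (n + 1)], and the squared step
    [1 / 4]. *)
Lemma avgB_sqrS n : avgB n.+1 (fun k => (k%:R - n.+1%:R / 2) ^+ 2) =
  (n%:R - 1) / n.+1%:R * avgB n (fun k => (k%:R - n%:R / 2) ^+ 2) + 4^-1.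
Proof.
have n0 : n.+1%:R != 0 :> R by rewrite pnatr_eq0.
rewrite avgBS -[4^-1 in RHS]mulr1 -[X in 4^-1 * X](avgB_cst n) -avgB_lin.
apply: eq_avgB => k; rewrite -[k.+1%:R]natr1 -[n.+1%:R]natr1 in n0 *.
by field.
Qed.

Lemma avgB_variance n : (2 <= n)%N ->
  avgB n (fun k => (k%:R - n%:R / 2) ^+ 2) = (n%:R + 1) / 12.
Proof.
elim: n => // n IH; rewrite leq_eqVlt => /orP[/eqP <-|].
  (* Passing from 1 to 2, the factor [n - 1] vanishes and erases the initial values; the formula
     starts with variance [1 / 4]. *)
  by rewrite !avgB_sqrS; field.
rewrite ltnS => n2; rewrite avgB_sqrS IH // -[n.+1%:R]natr1.
have n0 : n%:R + 1 != 0 :> R by rewrite natr1 pnatr_eq0.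
by field.
Qed.

(** A cruder bound that also covers [n = 0] and [n = 1], where the telescoping sum of the limit
    theorem begins. *)
Lemma avgB_variance_le n :
  avgB n (fun k => (k%:R - n%:R / 2) ^+ 2) <= (n%:R + 1) / 4.
Proof.
case: n => [|[|n]]; first by rewrite avgB0; lra.
  by rewrite avgB_sqrS avgB0; lra.
by rewrite avgB_variance // natr1; have := ler0n R n.+3; lra.
Qed.

(** The signed sums only see finite differences of order at least [n - 1], so
    they vanish on polynomials of lower degree. *)
Lemma sum_Dn_part_low c n r g : (r <= n - odd n)%N ->
  (forall j, iter r fdiff g j = 0) ->
  4 * \sum_(p in Dn_part c n) g (excD p) = signed_sum 1 1 n g.
Proof.
move=> rn g0.
rewrite sum_Dn_part !signed_sum_negs ?sqrrN ?expr1n // signed_sum_inv.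
rewrite (iter_fdiff_eq0 _ (leq_trans rn (leq_subr _ _)) g0).
(* For odd [n] the difference in [signed_sum_inv] has order [n - 1] only, whence [n - odd n] in the
   bound on [r]. *)
rewrite !addr0; case: ifP rn => _; rewrite ?subn1 ?subn0 => rn.
  rewrite (iter_fdiff_eq0 _ rn) ?mulr0 ?addr0 // => j.
  rewrite (@eq_iter_fdiff _ _ _ (fun k => 1 * g k + 1 * g k.+1)); last by move=> k; rewrite !mul1r.
  by rewrite iter_fdiff_lin iter_fdiff_shift !g0 !mulr0 addr0.
by rewrite mulr0 addr0.
Qed.

Lemma card_Dn_part c n : (2 <= n)%N -> 4 * #|Dn_part c n|%:R = (2 ^ n * n`!)%:R :> R.
Proof.
move=> n2; have h1 : (1 <= n - odd n)%N by case: odd; lia.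
have := @sum_Dn_part_low c n 1 (fun=> 1) h1 _; rewrite sumr_const -mulr_natl => ->; last first.
  by move=> j; rewrite /= /fdiff subrr.
by rewrite signed_sum11 sumr_const card_prod card_ffun card_bool card_Sn card_ord.
Qed.

Lemma Dn_part_average c n r g : (2 <= n)%N -> (r <= n - odd n)%N ->
  (forall j, iter r fdiff g j = 0) ->
  (\sum_(p in Dn_part c n) g (excD p)) / #|Dn_part c n|%:R = avgB n g.
Proof.
move=> n2 rn g0; rewrite /avgB -(sum_Dn_part_low c rn g0) -(card_Dn_part c n2).
by rewrite -mulf_div divff ?mul1r ?pnatr_eq0.
Qed.

End Average.

Lemma unif_mean_Dn_part (R : realType) c n : (3 <= n)%N ->
  unif_mean R (Dn_part c n) (@excD n) = n%:R / 2.
Proof.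
move=> n3; rewrite -avgB_mean -(@Dn_part_average _ c n 2) //; first exact: ltnW.
  by case: odd; lia.
by move=> j; rewrite /= /fdiff -!natr1; ring.
Qed.

(** Third differences of a square vanish, and [n - odd n] is at least 3 from [n = 4] on, while it is
    2 at [n = 3]. *)
Lemma unif_variance_Dn_part (R : realType) c n : (4 <= n)%N ->
  unif_variance R (Dn_part c n) (@excD n) = (n%:R + 1) / 12.
Proof.
move=> n4; have n3 : (3 <= n)%N by lia.
have r3 : (3 <= n - odd n)%N.
  by move: n4; rewrite leq_eqVlt => /orP[/eqP <- //|]; case: odd; lia.
rewrite /unif_variance unif_mean_Dn_part // -avgB_variance; last by lia.
rewrite -(@Dn_part_average _ c n 3) //; first by lia.
by move=> j; rewrite /= /fdiff -!natr1; ring.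
Qed.

(** * The normal distribution function *)

Section NormalCdf.
Variable R : realType.
Implicit Types (x y z : R).

Local Notation phi := (@normal_pdf R 0 1).

Lemma is_derive_Phi x : is_derive x 1 (@Phi R) (phi x).
Proof.
have x1 : x < x + 1 by rewrite ltrDl.
have intphi : (@lebesgue_measure R).-integrable
    [set` Interval (BInfty R true) (BRight (x + 1))] (EFin \o phi).
  apply: (@integrableS _ _ R lebesgue_measure [set: R]%classic) => //.
  exact: integrable_normal_pdf.
have cphi : {for x, continuous phi}.
  by apply: continuous_normal_pdf; exact: oner_neq0.
have [|derF <-] := continuous_FTC1 x1 intphi _ cphi; first by rewrite ltNyr.
by rewrite derive1E; exact: derivableP.
Qed.

Lemma normal_pdf01E z : phi z = normal_peak 1 * expR (- z ^+ 2 / 2).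
Proof. by rewrite normal_pdfE ?oner_neq0 // /normal_fun subr0 expr1n. Qed.

Lemma is_derive_phi z : is_derive z 1 phi (- z * phi z).
Proof.
have -> : phi = fun y => normal_peak 1 * expR (- y ^+ 2 / 2).
  by apply/funext => y; rewrite normal_pdf01E.
apply: is_derive_eq.
by rewrite /GRing.scale /=; field.
Qed.

(** The identity serves as a random variable under the normal law; [Phi] is its distribution
    function, so general facts on [cdf] apply. *)
Let idTR : measurableTypeR R -> R := idfun.

#[local] HB.instance Definition _ :=
  @isMeasurableFun.Build _ _ _ _ idTR (@measurable_id _ _ [set: _]%classic).

Let idX : {RV (normal_prob 0 1 : probability _ R) >-> R} := idTR.

Lemma Phi_ge0 x : 0 <= Phi x.
Proof. by apply: fine_ge0; exact: measure_ge0. Qed.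

Lemma fin_num_normal_prob (A : set R) : measurable A ->
  normal_prob (0 : R) 1 A \is a fin_num.
Proof. by move=> mA; exact: (@fin_num_measure _ _ _ (normal_prob 0 1)). Qed.

Lemma Phi_cdf : @Phi R = fine \o cdf idX.
Proof. by []. Qed.

Lemma Phi_le1 x : Phi x <= 1.
Proof.
rewrite -lee_fin fineK; last exact: fin_num_normal_prob.
exact: (@cdf_le1 _ _ _ _ idX).
Qed.

Lemma le_Phi x y : x <= y -> Phi x <= Phi y.
Proof.
move=> xy; apply: fine_le; rewrite ?fin_num_normal_prob //.
exact: (@cdf_nondecreasing _ _ _ _ idX).
Qed.

Lemma Phi_tails (eps : R) : 0 < eps ->
  exists2 K : R, 0 < K & Phi (- K) <= eps /\ 1 - eps <= Phi K.
Proof.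
move=> e0.
have h1 : (@Phi R @ +oo --> (1 : R))%classic.
  by rewrite Phi_cdf; apply/fine_cvg; exact: cvg_cdfy1.
have h0 : (@Phi R @ -oo --> (0 : R))%classic.
  by rewrite Phi_cdf; apply/fine_cvg; exact: cvg_cdfNy0.
have [M1 [_ HM1]] : (\forall y \near +oo, `|1 - Phi y| < eps)%classic.
  by move/cvgrPdist_lt : h1; apply.
have [M0 [_ HM0]] : (\forall y \near -oo, `|0 - Phi y| < eps)%classic.
  by move/cvgrPdist_lt : h0; apply.
exists (1 + `|M1| + `|M0|); first by rewrite -addrA ltr_pwDl // addr_ge0.
have := ler_norm M1; have := ler_norm (- M0); rewrite normrN => m0 m1.
have n0 := normr_ge0 M0; have n1 := normr_ge0 M1.
split.
  have /= := HM0 (- (1 + `|M1| + `|M0|)); rewrite sub0r normrN (ger0_norm (Phi_ge0 _)) => h.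
  by apply/ltW/h; lra.
have /= := HM1 (1 + `|M1| + `|M0|); rewrite [X in X < eps]ger0_norm ?subr_ge0 ?Phi_le1 // => h.
suff : 1 - Phi (1 + `|M1| + `|M0|) < eps by lra.
by apply: h; lra.
Qed.

Lemma phi_ge0 z : 0 <= phi z.
Proof. exact: normal_pdf_ge0. Qed.

(** The peak is at most 1, and [expR (z ^ 2 / 2) >= (1 + z ^ 2 / 4) ^ 2], whose multiple by 8
    dominates [|z| ^ k] for [k <= 3]. *)
Lemma phi_moment k z : (k <= 3)%N -> `|z ^+ k * phi z| <= 8.
Proof.
move=> k3.
have peak1 : normal_peak (1 : R) <= 1.
  rewrite /normal_peak invf_le1 ?sqrtr_gt0; last first.
    by rewrite expr1n mul1r mulrn_wgt0 // pi_gt0.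
  rewrite -[leLHS]sqrtr1 ler_sqrt; last by rewrite expr1n mul1r mulrn_wge0 // pi_ge0.
  by have := pi_ge2 R; rewrite expr1n mul1r; lra.
have E : 0 < expR (z ^+ 2 / 2) by exact: expR_gt0.
have expB : (1 + z ^+ 2 / 4) ^+ 2 <= expR (z ^+ 2 / 2).
  have -> : z ^+ 2 / 2 = 2%:R * (z ^+ 2 / 4) by field.
  rewrite expRM_natl.
  rewrite lerXn2r ?nnegrE ?expR_ge0 ?expR_ge1Dx //.
  by have := sqr_ge0 z; lra.
rewrite normrM (ger0_norm (phi_ge0 z)) normal_pdf01E mulNr expRN.
rewrite mulrA ler_pdivrMr //.
apply: (@le_trans _ _ `|z ^+ k|).
  by rewrite ler_piMr.
apply: (@le_trans _ _ (8 * (1 + z ^+ 2 / 4) ^+ 2)); last by lra.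
have : `|z| ^+ 2 = z ^+ 2 by rewrite -normrX ger0_norm // sqr_ge0.
rewrite normrX => <-; have := normr_ge0 z; move: `|z| => w w0.
by case: k k3 => [|[|[|[|]]]] // _; nra.
Qed.

End NormalCdf.

(** * The heat equation and the Lindeberg step *)

Section Taylor.
Variable R : realType.
Implicit Types (f : R -> R) (a b x : R).

Lemma MVT_between f f1 a b :
  (forall y, Num.min a b <= y <= Num.max a b -> is_derive y 1 f (f1 y)) ->
  exists2 c, Num.min a b <= c <= Num.max a b & f b - f a = f1 c * (b - a).
Proof.
have MVT_le (u v : R) : u <= v -> (forall y, u <= y <= v -> is_derive y 1 f (f1 y)) ->
    exists2 c, u <= c <= v & f v - f u = f1 c * (v - u).
  move=> uv df; have [||c] := @MVT_segment R f f1 u v uv.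
  - by move=> y; rewrite in_itv /= => /andP[uy yv]; apply: df; rewrite !ltW.
  - apply: derivable_within_continuous => y; rewrite in_itv /= => /df.
    exact: @ex_derive.
  by rewrite in_itv /= => ? ?; exists c.
have [ab|/ltW ba] := leP a b => df; first exact: MVT_le.
have [c cab fE] := MVT_le _ _ ba df; exists c => //.
by rewrite -opprB fE -mulrN opprB.
Qed.

Lemma taylor2 f f1 f2 (C a b : R) :
  (forall y, Num.min a b <= y <= Num.max a b ->
    [/\ is_derive y 1 f (f1 y), is_derive y 1 f1 (f2 y) & `|f2 y| <= C]) ->
  `|f b - f a - f1 a * (b - a)| <= C * (b - a) ^+ 2.
Proof.
move=> H; have [|c cab ->] := @MVT_between f f1 a b; first by move=> y /H [].
have sub y : Num.min a c <= y <= Num.max a c -> Num.min a b <= y <= Num.max a b.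
  by move: cab; case: (leP a b); case: (leP a c); lra.
have [|d /sub/H [_ _ dC] f1E] := @MVT_between f1 f2 a c; first by move=> y /sub/H [].
rewrite -mulrBl f1E -mulrA normrM ler_pM // normrM.
have ca : `|c - a| <= `|b - a|.
  move: cab; case: (leP a b) => ab /andP[? ?].
    by rewrite !ger0_norm ?subr_ge0 // lerD2r.
  by rewrite !ler0_norm ?subr_le0 // ?lerN2 ?lerD2r // ltW.
by rewrite -real_normK ?num_real // expr2 ler_wpM2r.
Qed.

(** Subtracting the quadratic term reduces to [taylor2]: the second derivative becomes
    [f2 y - f2 a], at most [C * |h|] on the segment. *)
Lemma taylor3 f f1 f2 f3 (C a h : R) :
  (forall y : R, [/\ is_derive y 1 f (f1 y), is_derive y 1 f1 (f2 y),
                 is_derive y 1 f2 (f3 y) & `|f3 y| <= C]) ->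
  `|f (a + h) - f a - f1 a * h - f2 a * h ^+ 2 / 2| <= C * `|h| ^+ 3.
Proof.
move=> H.
have [k kE] : exists k, k = f2 a by exists (f2 a).
rewrite -kE.
pose g y := f y - k / 2 * (y - a) ^+ 2.
pose g1 y := f1 y - k * (y - a).
pose g2 y := f2 y - k.
have := @taylor2 g g1 g2 (C * `|h|) a (a + h) _.
have -> : g (a + h) - g a - g1 a * (a + h - a) =
    f (a + h) - f a - f1 a * h - k * h ^+ 2 / 2.
  by rewrite /g /g1; field.
rewrite [a + h - a]addrC addrA addNr add0r.
have -> : C * `|h| ^+ 3 = C * `|h| * h ^+ 2.
  by rewrite -[h ^+ 2]real_normK ?num_real //; ring.
apply => y yab; have [df df1 df2 f3C] := H y; split.
- by rewrite /g; apply: is_derive_eq; rewrite /g1 /GRing.scale /=; field.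
- have -> : g1 = f1 - k \*: (id - cst a) by apply/funext => w; rewrite /g1 !fctE.
  by apply: is_derive_eq; rewrite /g2 /GRing.scale /=; ring.
- rewrite /g2 kE; have [|c _ ->] := @MVT_between f2 f3 a y; first by move=> z _; have [] := H z.
  rewrite normrM; apply: ler_pM => //; first by have [] := H c.
  move: yab; case: (leP a (a + h)) => ah /andP[? ?]; rewrite ler_norml.
    by rewrite ger0_norm; lra.
  by rewrite ltr0_norm; lra.
Qed.

End Taylor.

Section Heat.
Variable R : realType.
Implicit Types (a c r x h tau delta : R).
Local Notation phi := (@normal_pdf R 0 1).

Lemma phi_bound x : `|phi x| <= 8.
Proof. by rewrite -[phi x]mul1r -(expr0 x); exact: phi_moment. Qed.

Lemma xphi_bound x : `|x * phi x| <= 8.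
Proof. by rewrite -[x in x * _]expr1; exact: phi_moment. Qed.

(** With [z = (a - y) / r], the third derivative in [y] is [(phi z - z ^ 2 * phi z) / r ^ 3]; two
    uses of [phi_moment] give [8 + 8 = 16]. *)
Lemma heat_space a r x h : 0 < r ->
  `|Phi ((a - (x + h)) / r) - Phi ((a - x) / r)
    - (- phi ((a - x) / r) / r) * h
    - (- ((a - x) / r * phi ((a - x) / r)) / r ^+ 2) * h ^+ 2 / 2|
  <= 16 / r ^+ 3 * `|h| ^+ 3.
Proof.
move=> r0.
pose z y := (a - y) / r.
have rn0 : r != 0 by rewrite gt_eqF.
have dz (y : R) : is_derive y 1 z (- r^-1).
  rewrite /z; apply: is_derive_eq; rewrite /GRing.scale /=; field.
  by [].
apply: (@taylor3 R (fun y => Phi (z y)) (fun y => - phi (z y) / r)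
  (fun y => - (z y * phi (z y)) / r ^+ 2)
  (fun y => ((z y) ^+ 0 * phi (z y) - (z y) ^+ 2 * phi (z y)) / r ^+ 3)) => y.
have dP := is_derive1_comp (is_derive_Phi (z y)) (dz y).
have dp := is_derive1_comp (is_derive_phi (z y)) (dz y).
split.
- by apply: is_derive_eq dP _; field.
- have -> : (fun y => - phi (z y) / r) = (- r^-1) \*: (phi \o z).
    by apply/funext => w /=; rewrite /GRing.scale /=; field.
  by apply: is_derive_eq; rewrite /GRing.scale /=; field.
- have -> : (fun y => - (z y * phi (z y)) / r ^+ 2) = (- r ^- 2) \*: (z * (phi \o z)).
    by apply/funext => w /=; rewrite /GRing.scale /= !fctE /=; field.
  by apply: is_derive_eq; rewrite /GRing.scale /=; field.
- rewrite normrM ler_pM //; last by rewrite ger0_norm // invr_ge0 exprn_ge0 // ltW.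
  rewrite (le_trans (ler_normB _ _)) //.
  by have := @phi_moment R 0 (z y) isT; have := @phi_moment R 2 (z y) isT; lra.
Qed.

Lemma is_derive_cstV c r : r != 0 ->
  is_derive r 1 (fun y : R => c / y) (- c / r ^+ 2).
Proof.
move=> rn0; have dV := @is_deriveV R id r 1 1 rn0 (is_derive_id _ _).
have -> : (fun y : R => c / y) = c \*: (fun y : R => (id y)^-1) by [].
by apply: is_derive_eq; rewrite /GRing.scale /=; field.
Qed.

Lemma is_derive_Phi_div c r : 0 < r ->
  is_derive r 1 (fun y => Phi (c / y)) (- (c / r * phi (c / r)) / r).
Proof.
move=> r0; have rn0 : r != 0 by rewrite gt_eqF.
have dz := is_derive_cstV c rn0.
have dP := @is_derive1_comp R (@Phi R) (fun y => c / y) r _ _ (is_derive_Phi (c / r)) dz.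
by apply: is_derive_eq dP _; field.
Qed.

Lemma heat_time_sqrt c r r' : 0 < r -> r <= r' ->
  `|Phi (c / r') - Phi (c / r) - (- (c / r * phi (c / r)) / r) * (r' - r)|
  <= 24 / r ^+ 2 * (r' - r) ^+ 2.
Proof.
move=> r0 rr'.
apply: (@taylor2 R (fun y => Phi (c / y)) (fun y => - (c / y * phi (c / y)) / y)
  (fun y => (2 * ((c / y) ^+ 1 * phi (c / y)) - (c / y) ^+ 3 * phi (c / y)) / y ^+ 2)).
move=> y; rewrite (min_l rr') (max_r rr') => /andP[ry yr'].
have y0 : 0 < y by exact: lt_le_trans ry.
have yn0 : y != 0 by rewrite gt_eqF.
split; first exact: is_derive_Phi_div.
- have dz := is_derive_cstV c yn0.
  have dV := @is_deriveV R id y 1 1 yn0 (is_derive_id _ _).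
  have dp := @is_derive1_comp R phi (fun y => c / y) y _ _ (is_derive_phi (c / y)) dz.
  have -> : (fun y => - (c / y * phi (c / y)) / y) =
      - ((fun y => c / y) * (phi \o (fun y => c / y)) * (fun y => y^-1)).
    by apply/funext => w /=; rewrite !fctE /= mulNr.
  apply: is_derive_eq; rewrite /GRing.scale /= !fctE /=; field.
  by [].
- rewrite normrM ler_pM //.
    rewrite (le_trans (ler_normB _ _)) // normrM (ger0_norm (_ : 0 <= 2)) //.
    by have := @phi_moment R 1 (c / y) isT; have := @phi_moment R 3 (c / y) isT; lra.
  rewrite ger0_norm ?invr_ge0 ?exprn_ge0 ?(ltW y0) // lef_pV2 ?posrE ?exprn_gt0 //.
  by rewrite lerXn2r // nnegrE ltW.
Qed.

(** The expansion is done in [r = sqrt tau], with increment [D] and [h = D * (2 * r + D)]. Returning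
    to [h] adds at most [4 * D ^ 2 / r ^ 2] to the error [24 * D ^ 2 / r ^ 2], and [2 * r * D <= h]
    turns the total into [7 * (h / tau) ^ 2]. *)
Lemma heat_time c tau h z : 0 < tau -> 0 <= h -> z = c / Num.sqrt tau ->
  `|Phi (c / Num.sqrt (tau + h)) - Phi z - (- (z * phi z) / tau) * h / 2|
  <= 7 * (h / tau) ^+ 2.
Proof.
move=> t0 h0 zE.
have r0 : 0 < Num.sqrt tau by rewrite sqrtr_gt0.
have rr' : Num.sqrt tau <= Num.sqrt (tau + h) by rewrite ler_wsqrtr // lerDl.
have tauE : Num.sqrt tau ^+ 2 = tau by rewrite sqr_sqrtr ?ltW.
have tau'E : Num.sqrt (tau + h) ^+ 2 = tau + h by rewrite sqr_sqrtr ?addr_ge0 ?(ltW t0).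
have := heat_time_sqrt c r0 rr'; rewrite -zE => {zE}.
move: (Num.sqrt tau) (Num.sqrt (tau + h)) r0 rr' tauE tau'E => r r' r0 rr' tauE tau'E.
have [D D0 r'E] : exists2 D, 0 <= D & r' = r + D.
  by exists (r' - r); [rewrite subr_ge0|rewrite addrC subrK].
have hE : h = D * (2 * r + D) by rewrite -[h](addKr tau) -tau'E -tauE r'E; ring.
rewrite r'E [r + D - r]addrC addrA addNr add0r => H.
have rn0 : r != 0 by rewrite gt_eqF.
rewrite -tauE.
set P := Phi _ in H *; set Q := Phi _ in H *.
have -> : P - Q - (- (z * phi z) / r ^+ 2) * h / 2 =
   (P - Q - (- (z * phi z) / r) * D) + (z * phi z) * (D ^+ 2 / r ^+ 2) / 2.
  by rewrite hE; field.
apply: (@le_trans _ _ (28 * (D ^+ 2 / r ^+ 2))).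
  rewrite (le_trans (ler_normD _ _)) //.
  have -> : 28 * (D ^+ 2 / r ^+ 2) = 24 / r ^+ 2 * D ^+ 2 + 8 * (D ^+ 2 / r ^+ 2) / 2.
    by field.
  rewrite lerD // normrM [X in _ * X <= _]ger0_norm // ler_pM // normrM ler_pM ?xphi_bound //.
  by rewrite ger0_norm // mulr_ge0 ?sqr_ge0 // invr_ge0 sqr_ge0.
have -> : 28 * (D ^+ 2 / r ^+ 2) = 7 * (2 * D / r) ^+ 2 by field.
rewrite ler_pM2l // lerXn2r ?nnegrE ?divr_ge0 ?mulr_ge0 ?sqr_ge0 ?(ltW r0) //.
rewrite ler_pdivrMr // mulrAC ler_pdivlMr ?exprn_gt0 // hE.
have -> : 2 * D * r ^+ 2 = D * (2 * r) * r by ring.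
by rewrite ler_wpM2r ?(ltW r0) // ler_wpM2l // lerDl.
Qed.

(** The time derivative of [Phi ((a - x) / sqrt tau)] is half its second space
    derivative, so a centered increment of variance [h] is compensated by an
    increase [h] of [tau]. *)
Lemma lindeberg_step a x tau h p d d' M : 0 < tau -> 0 <= h -> 0 <= p <= 1 ->
  p * d + (1 - p) * d' = 0 -> `|d| <= M -> `|d'| <= M ->
  `|p * Phi ((a - (x + d)) / Num.sqrt tau) +
    (1 - p) * Phi ((a - (x + d')) / Num.sqrt tau) -
    Phi ((a - x) / Num.sqrt (tau + h))| <=
  4 / tau * `|p * d ^+ 2 + (1 - p) * d' ^+ 2 - h| +
  16 / Num.sqrt tau ^+ 3 * M ^+ 3 + 7 * (h / tau) ^+ 2.
Proof.
move=> t0 h0 /andP[p0 p1] centered dM d'M.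
have r0 : 0 < Num.sqrt tau by rewrite sqrtr_gt0.
have := heat_space a x d r0; have := heat_space a x d' r0.
have := heat_time t0 h0 (erefl ((a - x) / Num.sqrt tau)).
rewrite sqr_sqrtr ?(ltW t0) //.
set z := (a - x) / Num.sqrt tau.
set P := Phi z; set P1 := Phi (_ / _); set P2 := Phi (_ / _); set P3 := Phi (_ / _).
set E1 := P1 - P - _; set E2 := P2 - P - _ - _; set E3 := P3 - P - _ - _.
move=> b1 b2 b3.
(* First-order terms in space cancel by centering. Second-order ones combine with the time
   derivative into a multiple of the variance mismatch; the rest is Taylor remainder. *)
have -> : p * P3 + (1 - p) * P2 - P1 =
  (- (z * phi z) / tau / 2 * (p * d ^+ 2 + (1 - p) * d' ^+ 2 - h)
   + (- phi z / Num.sqrt tau) * (p * d + (1 - p) * d'))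
  + (p * E3 + (1 - p) * E2) - E1.
  rewrite /E1 /E2 /E3; field.
  by rewrite !gt_eqF.
rewrite centered mulr0 addr0 (le_trans (ler_normB _ _)) // lerD //.
rewrite (le_trans (ler_normD _ _)) // lerD //.
  rewrite normrM ler_wpM2r // normrM normrM normrN.
  rewrite (ger0_norm (_ : 0 <= tau^-1)) ?invr_ge0 ?(ltW t0) //.
  rewrite (ger0_norm (_ : 0 <= 2^-1)) // mulrAC ler_wpM2r ?invr_ge0 ?(ltW t0) //.
  by have := xphi_bound z; lra.
set K := 16 / Num.sqrt tau ^+ 3 in b2 b3 *.
have K0 : 0 <= K by rewrite mulr_ge0 // invr_ge0 exprn_ge0 // ltW.
have M0 : 0 <= M by exact: le_trans dM.
have c3 : `|E3| <= K * M ^+ 3 by rewrite (le_trans b3) // ler_wpM2l // lerXn2r.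
have c2 : `|E2| <= K * M ^+ 3 by rewrite (le_trans b2) // ler_wpM2l // lerXn2r.
have q0 : 0 <= 1 - p by rewrite subr_ge0.
rewrite (le_trans (ler_normD _ _)) // !normrM (ger0_norm p0) (ger0_norm q0).
have -> : K * M ^+ 3 = p * (K * M ^+ 3) + (1 - p) * (K * M ^+ 3) by ring.
by rewrite lerD // ler_wpM2l.
Qed.

Lemma Phi_lipschitz x h : `|Phi (x + h) - Phi x| <= 8 * `|h|.
Proof.
have [|c _ ->] := @MVT_between R (@Phi R) phi x (x + h).
  by move=> y _; exact: is_derive_Phi.
by rewrite normrM [x + h - x]addrC addrA addNr add0r ler_wpM2r // phi_bound.
Qed.

(** The derivative of [Phi (x / y)] in [y] is bounded by 8 for [y >= 1], uniformly in [x], and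
    [sqrt (1 + delta) - 1 <= delta]. *)
Lemma Phi_rescale x delta : 0 <= delta ->
  `|Phi (x / Num.sqrt (1 + delta)) - Phi x| <= 8 * delta.
Proof.
move=> d0; set r := Num.sqrt _.
have r1 : 1 <= r by rewrite -[leLHS]sqrtr1 ler_wsqrtr // lerDl.
have r2 : r ^+ 2 = 1 + delta by rewrite sqr_sqrtr // addr_ge0.
have [|c] := @MVT_between R (fun y => Phi (x / y)) (fun y => - (x / y * phi (x / y)) / y) 1 r.
  by move=> y; rewrite (min_l r1) => /andP[y1 _]; apply: is_derive_Phi_div; exact: lt_le_trans y1.
rewrite (min_l r1) => /andP[c1 _]; rewrite divr1 => ->.
have c0 : 0 < c by exact: lt_le_trans c1.
rewrite normrM ler_pM //.
  rewrite normrM normrN [X in _ * X]ger0_norm ?invr_ge0 ?(ltW c0) //.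
  rewrite ler_pdivrMr // (le_trans (xphi_bound _)) //.
  by rewrite ler_peMr.
by rewrite ger0_norm ?subr_ge0 //; nra.
Qed.

End Heat.

(** * The central limit theorem *)

Section CentralLimit.
Variable R : realType.
Implicit Types (a x delta eps : R) (j k n : nat).

Definition sigmaB n : R := Num.sqrt ((n%:R + 1) / 12).

Lemma sigmaB_sqr n : sigmaB n ^+ 2 = (n%:R + 1) / 12.
Proof. by rewrite sqr_sqrtr // divr_ge0 // natr1 ler0n. Qed.

Lemma sigmaB_gt0 n : 0 < sigmaB n.
Proof. by rewrite sqrtr_gt0 divr_gt0 // natr1 ltr0n. Qed.

Lemma sigmaB_inv_small (eta : R) : 0 < eta ->
  exists N, forall n, (N <= n)%N -> (sigmaB n)^-1 <= eta.
Proof.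
move=> e0; exists (Num.bound (12 * (eta ^- 2))) => n Nn.
rewrite -[eta]invrK lef_pV2 ?posrE ?invr_gt0 ?sigmaB_gt0 //.
have e1 : 0 <= eta^-1 by rewrite invr_ge0 ltW.
rewrite -[leLHS](ger0_norm e1) -sqrtr_sqr ler_wsqrtr // exprVn.
have b0 : 0 <= 12 * eta ^- 2 by rewrite mulr_ge0 // invr_ge0 sqr_ge0.
have := archi_boundP b0.
have : (Num.bound (12 * eta ^- 2))%:R <= n%:R :> R by rewrite ler_nat.
by move: (eta ^- 2) (_%:R) => u v; lra.
Qed.

(** The errors of [lindeberg_step] decrease in [tau]; keeping the time above [delta] makes them
    uniform over all steps. *)
Lemma lindeberg_step_unif a x delta tau h p d d' M :
  0 < delta -> delta <= tau -> 0 <= h -> 0 <= p <= 1 ->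
  p * d + (1 - p) * d' = 0 -> `|d| <= M -> `|d'| <= M ->
  `|p * Phi ((a - (x + d)) / Num.sqrt tau) +
    (1 - p) * Phi ((a - (x + d')) / Num.sqrt tau) -
    Phi ((a - x) / Num.sqrt (tau + h))| <=
  4 / delta * `|p * d ^+ 2 + (1 - p) * d' ^+ 2 - h| +
  (16 / Num.sqrt delta ^+ 3 * M ^+ 3 + 7 * (h / delta) ^+ 2).
Proof.
move=> d0 dt h0 p01 centered dM d'M.
have t0 : 0 < tau by exact: lt_le_trans dt.
have M0 : 0 <= M by exact: le_trans dM.
have tV : tau^-1 <= delta^-1 by rewrite lef_pV2.
apply: le_trans (lindeberg_step a x t0 h0 p01 centered dM d'M) _.
rewrite -addrA lerD //; first by rewrite ler_wpM2r // ler_wpM2l.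
rewrite lerD //.
  rewrite ler_wpM2r ?exprn_ge0 // ler_wpM2l //.
  rewrite lef_pV2 ?posrE ?exprn_gt0 ?sqrtr_gt0 //.
  by rewrite lerXn2r ?nnegrE ?sqrtr_ge0 // ler_wsqrtr.
rewrite ler_wpM2l // lerXn2r ?nnegrE ?divr_ge0 ?(ltW t0) ?(ltW d0) //.
by rewrite ler_wpM2l.
Qed.

Section Telescope.
Variables (a delta : R) (n : nat).
Hypotheses (d0 : 0 < delta) (n0 : (0 < n)%N).

Let w : R := (sigmaB n)^-1.
(** [j ^ 2 * (j + 1) / 12] is the variance of the martingale [j * Y_j], so [time]
    decreases from [1 + delta] at [j = 0] to [delta] at [j = n]. *)
Let time j : R := 1 + delta - (j%:R ^+ 2 * (j%:R + 1) / 12) * (w / n%:R) ^+ 2.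
(** The martingale [j * Y_j] is scaled by [w / n], so that its value at [j = n] is
    [Y_n / sigma_n]. *)
Let smoothed j k : R :=
  Phi ((a - j%:R * (k%:R - j%:R / 2) * (w / n%:R)) / Num.sqrt (time j)).
Let err : R := (2 / delta + 6 / delta ^+ 2) * (w ^+ 2 / n%:R) +
  192 / Num.sqrt delta ^+ 3 * (w / n%:R).

Let w0 : 0 < w. Proof. by rewrite invr_gt0 sigmaB_gt0. Qed.

Let w2 : (n%:R + 1) * w ^+ 2 = 12.
Proof.
by rewrite exprVn sigmaB_sqr invf_div mulrC divfK.
Qed.

Lemma telescope_step j : (j < n)%N ->
  `|avgB j.+1 (smoothed j.+1) - avgB j (smoothed j)| <= err.
Proof.
move=> jn.
set q := w / n%:R.
have nn0 : n%:R != 0 :> R by rewrite pnatr_eq0 -lt0n.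
have q0 : 0 < q by rewrite divr_gt0 // ltr0n.
have nq : n%:R * q = w by rewrite /q mulrC divfK.
have jn1 : (j%:R : R) + 1 <= n%:R by rewrite natr1 ler_nat.
have j0 : 0 <= (j%:R : R) by rewrite ler0n.
(* The decrease of [time] from [j] to [j + 1]. *)
set h := ((j%:R + 1) * (3 * j%:R + 2) / 12) * q ^+ 2.
have h0 : 0 <= h.
  by rewrite mulr_ge0 ?sqr_ge0 // divr_ge0 // mulr_ge0 //; lra.
have timeS : time j = time j.+1 + h.
  by rewrite /time /h -/q -[j.+1%:R]natr1; field.
have dt : delta <= time j.+1.
  rewrite /time -/q -[j.+1%:R]natr1.
  have : (j%:R + 1) ^+ 2 * (j%:R + 1 + 1) / 12 * q ^+ 2 <= n%:R ^+ 2 * (n%:R + 1) / 12 * q ^+ 2.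
    rewrite ler_wpM2r ?sqr_ge0 // ler_wpM2r //.
    by rewrite ler_pM ?sqr_ge0 // ?lerXn2r ?nnegrE ?addr_ge0 // lerD2r.
  have -> : n%:R ^+ 2 * (n%:R + 1) / 12 * q ^+ 2 = 1.
    have -> : n%:R ^+ 2 * (n%:R + 1) / 12 * q ^+ 2 = ((n%:R + 1) * (n%:R * q) ^+ 2) / 12 by field.
    by rewrite nq w2 divff.
  by lra.
set B := 16 / Num.sqrt delta ^+ 3 * w ^+ 3 + 7 * (h / delta) ^+ 2.
(* One Lindeberg step conditionally on [exc = k]; [k <= j] ensures that the weights lie in
   [[0, 1]]. *)
have pointwise k : (k <= j)%N ->
  `|((2^-1 - (k%:R - j%:R / 2) / j.+1%:R) * smoothed j.+1 k.+1 +
    (2^-1 + (k%:R - j%:R / 2) / j.+1%:R) * smoothed j.+1 k) - smoothed j k| <=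
  (4 / delta * q ^+ 2) * (k%:R - j%:R / 2) ^+ 2 +
  (4 / delta * q ^+ 2 * ((j%:R + 1) / 12) + B) * 1.
  move=> kj; set Y := k%:R - j%:R / 2.
  have Yj : `|Y| <= j%:R / 2.
    have : (k%:R : R) <= j%:R by rewrite ler_nat.
    by have := ler0n R k; rewrite ler_norml /Y; lra.
  set p := 2^-1 - Y / j.+1%:R.
  have jS0 : (j%:R : R) + 1 != 0 by rewrite natr1 pnatr_eq0.
  have jS1 : 0 < (j%:R : R) + 1 by rewrite natr1 ltr0n.
  have pE : p * (j%:R + 1) = (j%:R + 1) / 2 - Y.
    by rewrite /p -[j.+1%:R]natr1; field.
  have p01 : 0 <= p <= 1.
    move: Yj; rewrite ler_norml => /andP[Y1 Y2].
    have p0 : 0 <= p by rewrite -(pmulr_lge0 p jS1) pE; lra.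
    have p1 : 0 <= 1 - p by rewrite -(pmulr_lge0 (1 - p) jS1) mulrBl mul1r pE; lra.
    by rewrite p0 -subr_ge0 p1.
  (* The two scaled increments of the martingale: [(j + 1) * (Y + 1/2) - j * Y] and
     [(j + 1) * (Y - 1/2) - j * Y]. *)
  set d := (Y + (j%:R + 1) / 2) * q; set d' := (Y - (j%:R + 1) / 2) * q.
  have centered : p * d + (1 - p) * d' = 0.
    have -> : p * d + (1 - p) * d' = (p * (j%:R + 1) - ((j%:R + 1) / 2 - Y)) * q.
      by rewrite /d /d'; field.
    by rewrite pE subrr mul0r.
  have dw u : `|u| <= j%:R + 1 -> `|u * q| <= w.
    move=> uj; rewrite normrM (gtr0_norm q0) -nq ler_wpM2r ?(ltW q0) //.
    exact: le_trans uj jn1.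
  have dM : `|d| <= w.
    by apply: dw; move: Yj; rewrite !ler_norml => /andP[? ?]; lra.
  have d'M : `|d'| <= w.
    by apply: dw; move: Yj; rewrite !ler_norml => /andP[? ?]; lra.
  have -> : 2^-1 + Y / j.+1%:R = 1 - p by rewrite /p; field; rewrite natr1 in jS0 *.
  have -> : smoothed j.+1 k.+1 = Phi ((a - (j%:R * Y * q + d)) / Num.sqrt (time j.+1)).
    rewrite /smoothed -/q (_ : _ * _ * q = j%:R * Y * q + d) //.
    by rewrite /d /Y -[j.+1%:R]natr1 -[k.+1%:R]natr1; field.
  have -> : smoothed j.+1 k = Phi ((a - (j%:R * Y * q + d')) / Num.sqrt (time j.+1)).
    rewrite /smoothed -/q (_ : _ * _ * q = j%:R * Y * q + d') //.
    by rewrite /d' /Y -[j.+1%:R]natr1; field.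
  have -> : smoothed j k = Phi ((a - j%:R * Y * q) / Num.sqrt (time j.+1 + h)).
    by rewrite /smoothed -/q timeS.
  apply: le_trans (lindeberg_step_unif a _ d0 dt h0 p01 centered dM d'M) _.
  rewrite mulr1 [leRHS]addrA; apply: lerD; last exact: lexx.
  (* The conditional variance is [((j + 1) ^ 2 / 4 - Y ^ 2) * q ^ 2], and [h] has [(j + 1) / 12] in
     place of [Y ^ 2]. *)
  have -> : p * d ^+ 2 + (1 - p) * d' ^+ 2 - h = ((j%:R + 1) / 12 - Y ^+ 2) * q ^+ 2.
    rewrite (_ : _ - h = (2 * Y * (p * (j%:R + 1)) + Y ^+ 2
       - Y * (j%:R + 1) + (j%:R + 1) ^+ 2 / 4) * q ^+ 2 - h); last first.
      by rewrite /d /d'; field.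
    by rewrite pE /h; field.
  have -> : 4 / delta * q ^+ 2 * Y ^+ 2 + 4 / delta * q ^+ 2 * ((j%:R + 1) / 12) =
     4 / delta * ((Y ^+ 2 + (j%:R + 1) / 12) * q ^+ 2) by field; rewrite gt_eqF.
  rewrite ler_wpM2l ?divr_ge0 ?(ltW d0) //.
  rewrite normrM [X in _ * X]ger0_norm ?sqr_ge0 // ler_wpM2r ?sqr_ge0 //.
  have A0 : 0 <= (j%:R + 1) / 12 :> R by rewrite divr_ge0 // ltW.
  by rewrite (le_trans (ler_normB _ _)) // (ger0_norm A0) (ger0_norm (sqr_ge0 Y)) addrC.
have -> : avgB j.+1 (smoothed j.+1) - avgB j (smoothed j) =
  avgB j (fun k => 1 * ((2^-1 - (k%:R - j%:R / 2) / j.+1%:R) * smoothed j.+1 k.+1 +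
    (2^-1 + (k%:R - j%:R / 2) / j.+1%:R) * smoothed j.+1 k) + (-1) * smoothed j k).
  by rewrite avgB_lin mul1r mulN1r avgBS.
apply: le_trans (ler_norm_avgB _ _) _.
apply: (@le_trans _ _ (avgB j (fun k => (4 / delta * q ^+ 2) * (k%:R - j%:R / 2) ^+ 2 +
  (4 / delta * q ^+ 2 * ((j%:R + 1) / 12) + B) * 1))).
  by apply: le_avgB => k kj; rewrite mul1r mulN1r; exact: pointwise.
rewrite avgB_lin avgB_cst mulr1 addrA.
have K0 : 0 <= 4 / delta * q ^+ 2 by rewrite mulr_ge0 ?sqr_ge0 // divr_ge0 // ltW.
apply: (@le_trans _ _ (4 / delta * q ^+ 2 * ((j%:R + 1) / 4) +
    4 / delta * q ^+ 2 * ((j%:R + 1) / 12) + B)).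
  by rewrite lerD2r lerD2r ler_wpM2l // avgB_variance_le.
(* This trades a factor [w ^ 2] for [12 / n], giving [192 = 16 * 12] and [7 / 16 * 12 = 21 / 4 <= 6]
   below. *)
have w2n : w ^+ 2 <= 12 / n%:R.
  rewrite ler_pdivlMr ?ltr0n // -w2 mulrC ler_wpM2r ?sqr_ge0 //.
  by rewrite lerDl.
have dn0 : delta != 0 by rewrite gt_eqF.
have part1 : 4 / delta * q ^+ 2 * ((j%:R + 1) / 4) + 4 / delta * q ^+ 2 * ((j%:R + 1) / 12)
    <= 2 / delta * (w ^+ 2 / n%:R).
  have -> : 4 / delta * q ^+ 2 * ((j%:R + 1) / 4) + 4 / delta * q ^+ 2 * ((j%:R + 1) / 12) =
     4 / 3 / delta * q ^+ 2 * (j%:R + 1) by field.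
  apply: (@le_trans _ _ (4 / 3 / delta * q ^+ 2 * n%:R)).
    by rewrite ler_wpM2l // mulr_ge0 ?sqr_ge0 // divr_ge0 // ltW.
  have -> : 4 / 3 / delta * q ^+ 2 * n%:R = 4 / 3 / delta * (w ^+ 2 / n%:R).
    by rewrite /q; field; rewrite nn0 dn0.
  have wn : 0 <= w ^+ 2 / n%:R by rewrite divr_ge0 ?sqr_ge0.
  rewrite ler_wpM2r // ler_wpM2r ?invr_ge0 ?(ltW d0) //.
  by lra.
have part2 : 16 / Num.sqrt delta ^+ 3 * w ^+ 3 <= 192 / Num.sqrt delta ^+ 3 * (w / n%:R).
  have -> : 192 / Num.sqrt delta ^+ 3 * (w / n%:R) = 16 / Num.sqrt delta ^+ 3 * (12 / n%:R * w).
    by field; rewrite nn0 gt_eqF ?sqrtr_gt0.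
  rewrite ler_wpM2l ?divr_ge0 ?exprn_ge0 ?sqrtr_ge0 //.
  by rewrite exprSr ler_wpM2r // ltW.
have part3 : 7 * (h / delta) ^+ 2 <= 6 / delta ^+ 2 * (w ^+ 2 / n%:R).
  have hw : h <= w ^+ 2 / 4.
    apply: (@le_trans _ _ ((n%:R * q) ^+ 2 / 4)); last by rewrite nq.
    rewrite (_ : (n%:R * q) ^+ 2 / 4 = n%:R ^+ 2 / 4 * q ^+ 2); last by field.
    rewrite /h ler_wpM2r ?sqr_ge0 //.
    by nra.
  have h2 : h ^+ 2 <= (w ^+ 2 / 4) ^+ 2.
    by rewrite lerXn2r ?nnegrE // divr_ge0 ?sqr_ge0.
  have -> : 7 * (h / delta) ^+ 2 = (7 * h ^+ 2) * delta ^- 2 by field.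
  have -> : 6 / delta ^+ 2 * (w ^+ 2 / n%:R) = (6 * w ^+ 2 / n%:R) * delta ^- 2.
    by field; rewrite nn0 dn0.
  rewrite ler_wpM2r ?invr_ge0 ?sqr_ge0 //.
  apply: (@le_trans _ _ (7 * (w ^+ 2 / 4) ^+ 2)); first by rewrite ler_wpM2l.
  have -> : 7 * (w ^+ 2 / 4) ^+ 2 = (7 / 16 * w ^+ 2) * w ^+ 2 by field.
  apply: (@le_trans _ _ ((7 / 16 * w ^+ 2) * (12 / n%:R))).
    by rewrite ler_wpM2l // mulr_ge0 ?sqr_ge0.
  have -> : (7 / 16 * w ^+ 2) * (12 / n%:R) = (21 / 4 * w ^+ 2) / n%:R by field.
  rewrite ler_wpM2r // ?invr_ge0 ?ler0n // ler_wpM2r ?sqr_ge0 //; lra.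
rewrite /err /B [leRHS]addrC mulrDl; move: part1 part2 part3; lra.
Qed.

(** Telescoping over [n] steps costs [n * err]. The chain starts at the deterministic value 0 with
    time [1 + delta] and ends with time [delta]. *)
Lemma smooth_clt_bound :
  `|avgB n (fun k => Phi ((a - (k%:R - n%:R / 2) / sigmaB n) / Num.sqrt delta)) -
    Phi (a / Num.sqrt (1 + delta))| <=
  (2 / delta + 6 / delta ^+ 2) * w ^+ 2 + 192 / Num.sqrt delta ^+ 3 * w.
Proof.
have nn0 : n%:R != 0 :> R by rewrite pnatr_eq0 -lt0n.
have tele m : (m <= n)%N ->
    `|avgB m (smoothed m) - avgB 0 (smoothed 0)| <= m%:R * err.
  elim: m => [_|m IH mn]; first by rewrite subrr normr0 mul0r.
  rewrite -[X in `|X|](subrKA (avgB m (smoothed m))) (le_trans (ler_normD _ _)) //.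
  by rewrite -natr1 mulrDl mul1r addrC lerD // ?telescope_step // IH // ltnW.
have := tele n (leqnn n).
have -> : avgB 0 (smoothed 0) = Phi (a / Num.sqrt (1 + delta)).
  by rewrite avgB0 /smoothed /time expr0n /= !mul0r !subr0.
have timen : time n = delta.
  rewrite /time (_ : n%:R ^+ 2 * (n%:R + 1) / 12 * (w / n%:R) ^+ 2 =
    ((n%:R + 1) * w ^+ 2) / 12); last by field.
  by rewrite w2 divff //; ring.
rewrite (@eq_avgB _ _ (smoothed n)
    (fun k => Phi ((a - (k%:R - n%:R / 2) / sigmaB n) / Num.sqrt delta))); last first.
  move=> k; rewrite /smoothed timen.
  rewrite (_ : n%:R * (k%:R - n%:R / 2) * (w / n%:R) = (k%:R - n%:R / 2) * w) //.
  by field.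
move=> /le_trans; apply; rewrite le_eqVlt; apply/orP; left; apply/eqP.
rewrite /err; field.
by rewrite nn0 !gt_eqF ?sqrtr_gt0.
Qed.

End Telescope.
End CentralLimit.

Section CentralLimitCdf.
Variable R : realType.
Implicit Types (x delta eps : R) (n : nat).

Lemma smooth_clt delta eps : 0 < delta -> 0 < eps ->
  exists N, forall n, (N <= n)%N -> forall a,
  `|avgB n (fun k => Phi ((a - (k%:R - n%:R / 2) / sigmaB R n) / Num.sqrt delta)) -
    Phi (a / Num.sqrt (1 + delta))| <= eps.
Proof.
move=> d0 e0.
set A := 2 / delta + 6 / delta ^+ 2; set B := 192 / Num.sqrt delta ^+ 3.
have A0 : 0 < A by rewrite addr_gt0 // divr_gt0 // exprn_gt0.
have B0 : 0 < B by rewrite divr_gt0 ?exprn_gt0 ?sqrtr_gt0.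
have AB0 : 0 < A + B by exact: addr_gt0 A0 B0.
have [|N HN] := @sigmaB_inv_small R (Num.min 1 (eps / (A + B))).
  by rewrite lt_min ltr01 divr_gt0.
exists (maxn 1 N) => n; rewrite geq_max => /andP[n1 /HN].
rewrite le_min ler_pdivlMr // => /andP[w1 wAB] a.
apply: le_trans (smooth_clt_bound a d0 n1) _; rewrite -/A -/B.
apply: le_trans wAB; rewrite mulrDr [A * _]mulrC [B * _]mulrC lerD2r.
rewrite ler_wpM2r ?(ltW A0) // expr2 ler_piMl // invr_ge0 ltW //.
exact: sigmaB_gt0.
Qed.

Let sandwich (G e u u' r r' s s' y : R) : 0 <= e -> G <= 1 ->
  (1 - e) * G <= u -> u' <= G + e -> `|u - r| <= e -> `|u' - r'| <= e ->
  `|r - s| <= e -> `|r' - s'| <= e -> `|s - y| <= e -> `|s' - y| <= e ->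
  `|G - y| <= 4 * e.
Proof.
move=> e0 G1; have : e * G <= e by rewrite ler_piMr.
by rewrite mulrBl mul1r !ler_norml; move: (e * G) => v; lra.
Qed.

(** The indicator of [W <= x] is compared with [Phi ((x + K * t - W) / t)], at least [1 - e] where
    [W <= x], and with [Phi ((x - K * t - W) / t)], at most [e] where [W > x]. Smoothing, rescaling
    and shifting cost [e] each. *)
Lemma clt eps : 0 < eps ->
  exists N, forall n, (N <= n)%N -> forall x,
  `|avgB n (fun k => ((k%:R - n%:R / 2) / sigmaB R n <= x)%R%:R) - Phi x| <= eps.
Proof.
move=> eps0; set e := eps / 4; have e0 : 0 < e by rewrite divr_gt0.
have [K K0 [PhiNK PhiK]] := @Phi_tails R e e0.
(* Both [8 * t ^ 2 <= e], for the rescaling, and [8 * K * t <= e], for the shift, follow. *)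
set t := Num.min 1 (e / (8 * (K + 1))).
have K1 : 0 < 8 * (K + 1) by lra.
have t0 : 0 < t by rewrite lt_min ltr01 divr_gt0.
have [t1 tK] : t <= 1 /\ t * (8 * (K + 1)) <= e.
  by rewrite -ler_pdivlMr // /t; split; rewrite ge_min lexx ?orbT.
have d0 : 0 < t ^+ 2 by rewrite exprn_gt0.
have sqrtd : Num.sqrt (t ^+ 2) = t by rewrite sqrtr_sqr gtr0_norm.
have [N HN] := smooth_clt d0 e0; exists N => n nN x.
set W := fun k : nat => (k%:R - n%:R / 2) / sigmaB R n.
have smooth a : `|avgB n (fun k => Phi ((a - W k) / t)) -
    Phi (a / Num.sqrt (1 + t ^+ 2))| <= e.
  by have := HN n nN a; rewrite sqrtd.
set G := avgB n _.
have G1 : G <= 1.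
  rewrite -[leRHS](avgB_cst n); apply: le_avgB => k _; rewrite lern1; exact: leq_b1.
have rescale a : `|Phi (a / Num.sqrt (1 + t ^+ 2)) - Phi a| <= e.
  rewrite (le_trans (Phi_rescale a (ltW d0))) //; nra.
have shift s : `|s| = 1 -> `|Phi (x + s * (K * t)) - Phi x| <= e.
  move=> s1; rewrite (le_trans (Phi_lipschitz _ _)) // normrM s1 mul1r ger0_norm; nra.
have up : (1 - e) * G <= avgB n (fun k => Phi ((x + 1 * (K * t) - W k) / t)).
  rewrite -[leLHS]addr0 -[X in _ + X](mul0r (avgB n (fun=> 0))) -avgB_lin.
  apply: le_avgB => k _; rewrite mulr0 addr0 -/(W k); case: (lerP (W k) x) => Wx; last first.
    by rewrite mulr0 Phi_ge0.
  rewrite mulr1 (le_trans PhiK) // le_Phi // ler_pdivlMr // mul1r; lra.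
have down : avgB n (fun k => Phi ((x + (-1) * (K * t) - W k) / t)) <= G + e.
  have -> : G + e = 1 * G + 1 * avgB n (fun=> e) by rewrite avgB_cst !mul1r.
  rewrite -avgB_lin.
  apply: le_avgB => k _; rewrite !mul1r -/(W k); case: (lerP (W k) x) => Wx.
    by rewrite (le_trans (Phi_le1 _)) // lerDl ltW.
  rewrite add0r (le_trans _ PhiNK) // le_Phi // ler_pdivrMr //; lra.
have -> : eps = 4 * e by rewrite /e; field.
exact: (sandwich (ltW e0) G1 up down (smooth _) (smooth _) (rescale _) (rescale _)
  (shift 1 (normr1 _)) (shift (-1) (normrN1 _))).
Qed.

End CentralLimitCdf.

(** * Generating polynomials of statistics *)

Section CoefficientsOfGeneratingPolynomial.
Variables (R : realType) (T : finType) (A : {set T}) (f : T -> nat).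

Let P : {poly R} := \sum_(x in A) 'X^(f x).

Let coefP k : P`_k = \sum_(x in A) (k == f x)%:R.
Proof. by rewrite coef_sum; apply: eq_bigr => x _; rewrite coefXn. Qed.

Let coefP_ge0 k : 0 <= P`_k.
Proof. by rewrite coefP sumr_ge0. Qed.

Let hornerP1 : P.[1] = #|A|%:R.
Proof.
rewrite horner_sum -sum1_card natr_sum; apply: eq_bigr => x _.
by rewrite hornerXn expr1n.
Qed.

Let lt_sizeP x : x \in A -> (f x < size P)%N.
Proof.
move=> xA; rewrite ltnNge; apply/negP => /leq_sizeP/(_ _ (leqnn _)) /eqP.
by rewrite coefP (bigD1 x) //= eqxx gt_eqF // ltr_pwDl // sumr_ge0.
Qed.

(** Summation over the fibres of [f]; mean, variance and distribution function are instances. *)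
Lemma sum_coef_prob (g : nat -> R) :
  \sum_(k < size P) g k * coef_prob P k = (\sum_(x in A) g (f x)) / #|A|%:R.
Proof.
rewrite /coef_prob hornerP1.
under eq_bigr do rewrite mulrA; rewrite -mulr_suml; congr (_ / _).
under eq_bigr do rewrite coefP mulr_sumr; rewrite exchange_big /=.
apply: eq_bigr => x xA; rewrite (bigD1 (Ordinal (lt_sizeP xA))) //= eqxx mulr1.
rewrite big1 ?addr0 // => k; rewrite -(inj_eq val_inj) /= => /negbTE ->.
by rewrite mulr0.
Qed.

Lemma coef_mean_gen : coef_mean P = unif_mean R A f.
Proof. by rewrite /coef_mean (sum_coef_prob (fun k => k%:R)). Qed.

Lemma coef_variance_gen : coef_variance P = unif_variance R A f.
Proof.
by rewrite /coef_variance coef_mean_gen (sum_coef_prob (fun k => (k%:R - _) ^+ 2)).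
Qed.

Lemma coef_cdf_gen x : coef_cdf_std P x =
  (\sum_(z in A) ((f z)%:R <= x * Num.sqrt (unif_variance R A f) +
    unif_mean R A f)%R%:R) / #|A|%:R.
Proof.
rewrite /coef_cdf_std coef_mean_gen coef_variance_gen /=.
rewrite -(sum_coef_prob (fun k => (k%:R <= _)%R%:R)) big_mkcond /=.
apply: eq_bigr => k _; rewrite floor_ge_int.
by case: ifP => _; rewrite ?mul1r ?mul0r.
Qed.

Lemma has_coef_distribution_gen : (0 < #|A|)%N -> has_coef_distribution P.
Proof. by move=> A0; split; [exact: coefP_ge0|rewrite hornerP1 ltr0n]. Qed.

End CoefficientsOfGeneratingPolynomial.

(** * Asymptotic normality *)

Section AsymptoticNormality.
Variable R : realType.

Lemma Dn_part_gt0 c n : (2 <= n)%N -> (0 < #|Dn_part c n|)%N.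
Proof.
move=> n2; rewrite lt0n; apply/eqP => D0; have := card_Dn_part R c n2.
move/eqP; rewrite D0 mulr0 eq_sym pnatr_eq0 muln_eq0 expn_eq0 /=.
by rewrite -leqn0 leqNgt fact_gt0.
Qed.

(** Each of the three signed sums other than the full one is at most [2 ^ n], against [2 ^ n * n!]
    in the denominator; and [n! >= n]. *)
Lemma Dn_part_average_error c n (g : nat -> R) : (2 <= n)%N ->
  (forall k, `|g k| <= 1) ->
  `|(\sum_(p in Dn_part c n) g (excD p)) / #|Dn_part c n|%:R - avgB n g| <= 3 / n%:R.
Proof.
move=> n2 g1.
have dneg (y : R) : y ^+ 2 = 1 -> `|signed_sum (-1) y n g| <= 2 ^+ n.
  by move=> y2; rewrite signed_sum_negs // -[leRHS]mulr1; exact: iter_fdiff_bound.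
have dinv : `|signed_sum 1 (-1) n g| <= 2 ^+ n.
  rewrite signed_sum_inv; case: ifP => [|_]; last first.
    by rewrite -[leRHS]mulr1; exact: iter_fdiff_bound.
  case: n n2 {dneg} => // m _ _.
  rewrite exprSr; apply: iter_fdiff_bound => k.
  by rewrite (le_trans (ler_normD _ _)) // [leRHS](_ : _ = 1 + 1) // lerD.
have M0 : 0 < (2 ^ n * n`!)%:R :> R.
  by rewrite ltr0n muln_gt0 expn_gt0 fact_gt0.
have -> : (\sum_(p in Dn_part c n) g (excD p)) / #|Dn_part c n|%:R - avgB n g =
    (signed_sum (-1) 1 n g + (-1) ^+ c *
     (signed_sum 1 (-1) n g + signed_sum (-1) (-1) n g)) / (2 ^ n * n`!)%:R.
  have -> : (\sum_(p in Dn_part c n) g (excD p)) / #|Dn_part c n|%:R =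
      (4 * \sum_(p in Dn_part c n) g (excD p)) / (2 ^ n * n`!)%:R.
    by rewrite -(card_Dn_part R c n2) -mulf_div divff ?mul1r // pnatr_eq0.
  rewrite /avgB -mulrBl sum_Dn_part; congr (_ / _); ring.
rewrite normrM [X in _ * X]gtr0_norm ?invr_gt0 // ler_pdivrMr //.
apply: (@le_trans _ _ (3 * 2 ^+ n)).
  rewrite (le_trans (ler_normD _ _)) // normrM normrX normrN1 expr1n mul1r.
  have N1 : (-1) ^+ 2 = 1 :> R by rewrite sqrrN expr1n.
  have := dneg 1 (expr1n _ _); have := dneg (-1) N1.
  have := ler_normD (signed_sum 1 (-1) n g) (signed_sum (-1) (-1) n g).
  by move: dinv; lra.
have n0 : 0 < n%:R :> R by rewrite ltr0n; apply: leq_trans n2.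
rewrite natrM natrX (_ : 3 / n%:R * _ = 3 * 2 ^+ n * (n`!%:R / n%:R)); last first.
  by field; rewrite gt_eqF.
rewrite ler_peMr ?mulr_ge0 ?exprn_ge0 // ler_pdivlMr // mul1r ler_nat.
exact: fact_geq.
Qed.

Lemma DExc_asymptotically_normal (c : bool) :
  asymptotically_normal (fun n => \sum_(p in Dn_part c n) 'X^(excD p) : {poly R}).
Proof.
split.
  by exists 2%N => // n /= n2; apply: has_coef_distribution_gen; exact: Dn_part_gt0.
have bound (eps : R) : 0 < eps -> exists N, forall n, (N <= n)%N ->
    (0 <= ereal_sup [set `|coef_cdf_std
      (\sum_(p in Dn_part c n) 'X^(excD p) : {poly R}) x - Phi x|%:E | x in [set: R]]
    <= eps%:E)%E%classic.
  move=> eps0; have e2 : 0 < eps / 2 by rewrite divr_gt0.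
  have [N HN] := @clt R _ e2.
  (* The threshold 4 is for the variance, [N] for the limit theorem over [B_n], and the last for
     [3 / n <= eps / 2]. *)
  exists (maxn 4 (maxn N (Num.bound (6 / eps)))) => n.
  rewrite !geq_max => /and3P[n4 nN nb].
  apply/andP; split.
    apply: le_ereal_sup_tmp.
    exists (`|coef_cdf_std (\sum_(p in Dn_part c n) 'X^(excD p) : {poly R}) 0 - Phi 0|%:E).
      by exists 0.
    by rewrite lee_fin.
  apply: ge_ereal_sup => _ [x _ <-]; rewrite lee_fin.
  rewrite coef_cdf_gen unif_variance_Dn_part // unif_mean_Dn_part; last exact: ltnW.
  pose g k : R := ((k%:R - n%:R / 2) / sigmaB R n <= x)%R%:R.
  rewrite (eq_bigr (fun p => g (excD p))); last first.
    move=> p _; rewrite /g ler_pdivrMr ?sigmaB_gt0 // lerBlDr //.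
  have n2 : (2 <= n)%N by apply: leq_trans n4.
  have g1 k : `|g k| <= 1 by rewrite normr_nat lern1 leq_b1.
  have := Dn_part_average_error c n2 g1; have := HN n nN x; rewrite -/g.
  have n3 : 3 / n%:R <= eps / 2.
    rewrite ler_pdivrMr ?ltr0n; last by apply: leq_trans n4.
    have b0 : 0 <= 6 / eps by rewrite divr_ge0 // ltW.
    have := archi_boundP b0; rewrite ltr_pdivrMr // => h.
    have : (Num.bound (6 / eps))%:R * eps <= n%:R * eps by rewrite ler_pM2r // ler_nat.
    by lra.
  move=> h1 h2; rewrite -(subrKA (avgB n g)) (le_trans (ler_normD _ _)) //.
  by move: h1 h2 n3; lra.
(* Convergence in the extended reals needs the supremum to be eventually finite, which the bound
   with [eps = 1] gives. *)
apply/fine_cvgP; split.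
  have [N HN] := bound 1 ltr01; exists N => // n /= /HN /andP[h0 h1].
  by rewrite ge0_fin_numE // (le_lt_trans h1) // ltry.
apply/cvgrPdist_le => /= eps /bound [N HN]; exists N => // n /= /HN /andP[h0 h1].
rewrite sub0r normrN ger0_norm ?fine_ge0 //.
rewrite -lee_fin fineK //.
by rewrite ge0_fin_numE // (le_lt_trans h1) // ltry.
Qed.

End AsymptoticNormality.

Theorem theorem4p5 (R : realType) :
  asymptotically_normal (fun n => DExc_plus R n) /\
  asymptotically_normal (fun n => DExc_minus R n) /\
  (forall n : nat, (3 <= n)%N ->
     unif_mean R (Dn_plus n) (@excD n) = n%:R / 2 /\
     unif_mean R (Dn_minus n) (@excD n) = n%:R / 2) /\
  (forall n : nat, (4 <= n)%N ->
     unif_variance R (Dn_plus n) (@excD n) = (n%:R + 1) / 12 /\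
     unif_variance R (Dn_minus n) (@excD n) = (n%:R + 1) / 12).
Proof.
have plusE : (fun n => DExc_plus R n) = fun n => \sum_(p in Dn_part false n) 'X^(excD p).
  by apply/funext => n; rewrite /DExc_plus Dn_plusE.
have minusE : (fun n => DExc_minus R n) = fun n => \sum_(p in Dn_part true n) 'X^(excD p).
  by apply/funext => n; rewrite /DExc_minus Dn_minusE.
rewrite plusE minusE; split; first exact: DExc_asymptotically_normal.
split; first exact: DExc_asymptotically_normal.
split=> n n_ge; rewrite Dn_plusE Dn_minusE.
  by rewrite !unif_mean_Dn_part.
by rewrite !unif_variance_Dn_part.
Qed.
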